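(* Let $S(w)=7w^{6}+28w^{5}+28w^{4}-7w^{3}-14w^{2}+1$, let $F=\mathbb{Q}(\cos\tfrac{2\pi}{7})$ (a cyclic cubic field), and let $a_1=\tfrac{5\pi}{7}$, $a_3=\tfrac{2\pi}{7}$, $a_2=\arg\zeta$, where $\zeta$, $|\zeta|=1$, is a root of $$7\zeta^{12}+28\zeta^{11}+70\zeta^{10}+133\zeta^{9}+203\zeta^{8}+259\zeta^{7}+281\zeta^{6}+259\zeta^{5}+203\zeta^{4}+133\zeta^{3}+70\zeta^{2}+28\zeta+7=0,$$ so that $2\cos a_2=\zeta+\zeta^{-1}$ is a root of $S$. Then: (1) Over $F$ the sextic $S$ factors into three quadratics, which are conjugate under $\mathrm{Gal}(F/\mathbb{Q})$; hence $2\cos a_2$ has degree $2$ over $F$. (2) The angle field $L=\mathbb{Q}(\cos\tfrac{2\pi}{7},\cos a_2)$ is obtained from $\mathbb{Q}$ by the cyclic cubic extension $F/\mathbb{Q}$ followed by a single quadratic extension $L/F$, and $[L:\mathbb{Q}]=6=2\cdot 3$. (3) Let $p$ be the unit-distance realization of the braced heptagon graph $\{35,1\}$ given by the braced regular heptagon (the realization, described in the context, whose three free angles are $a_1,a_2,a_3$), and let $K=\mathbb{Q}(p)$ be the field generated over $\mathbb{Q}$ by its coordinates. Then $K$ is reached from $\mathbb{Q}$ by a tower of extensions of degrees $2$ and $3$, with $[K:\mathbb{Q}]=3\cdot 2^{k}$ for some integer $k\ge 0$; every step is realized by an $O5$ or $O6$ fold. Hence $\{35,1\}$ is origami-constructible: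 all coordinates of $p$ are origami numbers.
   Context: A unit-distance realization of a graph $G=(V,E)$ is a map $p:V\to\mathbb{R}^2$ with $\|p_u-p_v\|=1$ for every edge $\{u,v\}\in E$; it is faithful if in addition $\|p_u-p_v\|\ne 1$ for every non-adjacent pair. The graph $\{21,2\}$ has the $21$ vertices $(r,k)$, $r\in\{1,2,3\}$, $k\in\mathbb{Z}/7$, and $42$ edges (second indices modulo $7$): $(r,k)\sim(r,k+r)$, $(1,k)\sim(2,k+1)$, $(1,k)\sim(3,k-1)$, $(2,k)\sim(3,k-2)$. The braced heptagon $\{35,1\}$ ($19$ vertices, $35$ edges, minimum degree $3$) is the induced subgraph obtained by deleting the two adjacent vertices $(1,0)$ and $(1,1)$. Construction of realizations of $\{35,1\}$: the vertices are placed one after the other. A base edge is anchored with endpoints $(0,0)$ and $(1,0)$. Three free vertices are each placed at unit distance from one already placed neighbour $u$, at $p_u+(\cos\theta,\sin\theta)$, the angles $\theta$ being the three free parameters. Each of the other $14$ vertices $v$ (triangle vertices) is placed from two already placed neighbours at positions $c_1,c_2$ by $$p_v=\tfrac{c_1+c_2}{2}\pm\sqrt{\tfrac{1}{\|c_2-c_1\|^2}-\tfrac14}\,\bigl(-(c_2-c_1)^{\perp}\bigr),$$ one of the two intersections of the unit circles about $c_1,c_2$. This uses $32$ edges; the remaining three (unused) edges must have length $1$, and these are the closure conditions. Pegg's explicit construction gives a realization $p$ of this kind, the braced regular heptagon, whose free angles are $a_1,a_2,a_3$ as in the claim and at which the three unused edges have length exactly $1$. The fold $O5$ (fold a point $P$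 onto a line $r$, crease through a point $Q$) solves a quadratic; the Beloch fold $O6$ (fold $P_1\to r_1$ and $P_2\to r_2$ simultaneously) solves a cubic. A number $\alpha$ is an origami number iff it lies in a tower $\mathbb{Q}=K_0\subset K_1\subset\cdots\subset K_r\ni\alpha$ with each $[K_{i+1}:K_i]\in\{2,3\}$. *)

(* Defs.v *)
From HB Require Import structures.
From mathcomp Require Import all_boot all_order all_algebra.
From mathcomp Require Import all_classical all_reals all_analysis.
From mathcomp Require Export complex.
Export all_boot all_order all_algebra all_classical all_reals all_analysis.

Set Implicit Arguments.
Unset Strict Implicit.
Unset Printing Implicit Defensive.

Import Order.TTheory GRing.Theory Num.Theory.

Local Open Scope classical_set_scope.
Local Open Scope ring_scope.

(* Subfields of an ambient field R are represented by their sets of elements. *)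

Definition is_subfield (R : fieldType) (K : set R) : Prop :=
  GRing.divring_closed (mem K).

Definition adjoin (R : fieldType) (K A : set R) : set R :=
  smallest (@is_subfield R) (K `|` A).

Definition QQ (R : fieldType) : set R := range (@ratr R).
Arguments QQ : clear implicits.

Definition is_basis (R : fieldType) (K L : set R) (n : nat) (b : 'I_n -> R)
    : Prop :=
  [/\ forall i, L (b i),
      forall x, L x -> exists2 c : 'I_n -> R,
        (forall i, K (c i)) & x = \sum_(i < n) c i * b i
    & forall c : 'I_n -> R, (forall i, K (c i)) ->
        \sum_(i < n) c i * b i = 0 -> forall i, c i = 0].

(* L / K is a field extension and [L : K] = n. *)
Definition field_degree (R : fieldType) (K L : set R) (n : nat) : Prop :=
  [/\ is_subfield K, is_subfield L, K `<=` L
    & exists b : 'I_n -> R, is_basis K L b].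

(* s restricts to an element of Aut(L / K); its values outside L are
   irrelevant. *)
Definition is_aut (R : fieldType) (K L : set R) (s : R -> R) : Prop :=
  [/\ forall x, L x -> L (s x),
      forall y, L y -> exists2 x, L x & s x = y,
      forall x y, L x -> L y -> s (x + y) = s x + s y,
      forall x y, L x -> L y -> s (x * y) = s x * s y
    & forall x, K x -> s x = x].

Definition cyclic_extension (R : fieldType) (K L : set R) (n : nat) : Prop :=
  [/\ field_degree K L n,
      (forall x, L x -> (forall s, is_aut K L s -> s x = x) -> K x)
    & exists2 s, is_aut K L s
      & forall t, is_aut K L t ->
          exists m, forall x, L x -> t x = iter m s x].

Definition coefs_in (R : fieldType) (K : set R) (q : {poly R}) : Prop :=
  forall i, K q`_i.

Definition sextic (R : nzRingType) : {poly R} :=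
  7%:R *: 'X^6 + 28%:R *: 'X^5 + 28%:R *: 'X^4 - 7%:R *: 'X^3
  - 14%:R *: 'X^2 + 1.
Arguments sextic : clear implicits.

Definition zeta_poly (R : nzRingType) : {poly R} :=
  7%:R *: 'X^12 + 28%:R *: 'X^11 + 70%:R *: 'X^10 + 133%:R *: 'X^9
  + 203%:R *: 'X^8 + 259%:R *: 'X^7 + 281%:R *: 'X^6 + 259%:R *: 'X^5
  + 203%:R *: 'X^4 + 133%:R *: 'X^3 + 70%:R *: 'X^2 + 28%:R *: 'X + 7%:R%:P.
Arguments zeta_poly : clear implicits.

Definition F7 (R : realType) : set R := adjoin (QQ R) [set cos (2 * pi / 7)].
Arguments F7 : clear implicits.

(* zeta is a unimodular root of zeta_poly and a is its principal argument. *)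
Definition is_zeta_angle (R : realType) (zeta : R[i]) (a : R) : Prop :=
  [/\ `|zeta| = 1, root (zeta_poly R[i]) zeta, - pi < a <= pi
    & zeta = (cos a +i* sin a)%C].

Section Plane.
Variable R : realType.
Implicit Types P Q c : R * R.

Definition edist P Q : R :=
  Num.sqrt ((P.1 - Q.1) ^+ 2 + (P.2 - Q.2) ^+ 2).

Definition perp P : R * R := (- P.2, P.1).

(* The triangle vertex over c1, c2; the boolean selects the sign. *)
Definition triangle_point (sg : bool) c1 c2 : R * R :=
  let h := Num.sqrt (1 / edist c1 c2 ^+ 2 - 1 / 4) in
  let d := - perp (c2 - c1) in
  ((c1.1 + c2.1) / 2 + (-1) ^+ sg * h * d.1,
   (c1.2 + c2.2) / 2 + (-1) ^+ sg * h * d.2).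

Definition unit_distance_realization (V : finType) (e : rel V) (p : V -> R * R)
    : Prop :=
  forall u v, e u v -> edist (p u) (p v) = 1.

(* placed e p s th: the vertices in s, most recent first, are successively
   placed at the positions given by p, with th the angles of the free vertices
   among them. *)
Inductive placed (V : finType) (e : rel V) (p : V -> R * R)
    : seq V -> seq R -> Prop :=
| PlaceBase u v : e u v -> p u = (0, 0) -> p v = (1, 0) ->
    placed e p [:: v; u] [::]
| PlaceFree s th u v a : placed e p s th -> v \notin s -> u \in s -> e u v ->
    p v = p u + (cos a, sin a) ->
    placed e p (v :: s) (a :: th)
| PlaceTriangle s th u1 u2 v sg : placed e p s th -> v \notin s ->
    u1 \in s -> u2 \in s -> e u1 v -> e u2 v -> p u1 <> p u2 ->
    p v = triangle_point sg (p u1) (p u2) ->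
    placed e p (v :: s) th.

(* A realization obtained by a placement whose free angles are those of angles
   (in any order of placement); the edges not used by the placement are covered
   by unit_distance_realization. *)
Definition constructed_realization (V : finType) (e : rel V) (angles : seq R)
    (p : V -> R * R) : Prop :=
  unit_distance_realization e p /\
  exists s th, [/\ placed e p s th, forall v, v \in s & perm_eq th angles].

Definition coordinates (V : finType) (p : V -> R * R) : set R :=
  [set x | exists v, x = (p v).1 \/ x = (p v).2].

(* Lines in normal form, so that the entries of a line are determined by it. *)
Inductive line :=
| Oblique (m b : R)   (* y = m x + b *)
| Vertical (c : R).   (* x = c *)

Definition on_line (l : line) P : Prop :=
  match l with
  | Oblique m b => P.2 = m * P.1 + b
  | Vertical c => P.1 = c
  end.

Definition reflect_pt (l : line) P : R * R :=
  match l with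
  | Oblique m b => let t := (m * P.1 - P.2 + b) / (m ^+ 2 + 1) in
                   (P.1 - 2 * m * t, P.2 + 2 * t)
  | Vertical c => (2 * c - P.1, P.2)
  end.

Definition line_entries (l : line) : set R :=
  match l with
  | Oblique m b => [set m; b]
  | Vertical c => [set c]
  end.

Definition point_over (K : set R) P : Prop := K P.1 /\ K P.2.
Definition line_over (K : set R) (l : line) : Prop := line_entries l `<=` K.

(* The conditions ~ on_line r P, and (P1, r1) <> (P2, r2) for O6, exclude the
   degenerate configurations with infinitely many creases. *)
Definition O5_fold P (r : line) Q (crease : line) : Prop :=
  [/\ ~ on_line r P, on_line crease Q & on_line r (reflect_pt crease P)].

Definition O6_fold P1 (r1 : line) P2 (r2 : line) (crease : line) : Prop :=
  [/\ ~ on_line r1 P1, ~ on_line r2 P2, (P1, r1) <> (P2, r2),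
      on_line r1 (reflect_pt crease P1) & on_line r2 (reflect_pt crease P2)].

(* K' is generated over K by the crease of a fold whose data are defined
   over K. *)
Definition O5_step (K K' : set R) : Prop :=
  exists P r Q l, [/\ point_over K P, line_over K r, point_over K Q,
    O5_fold P r Q l & K' = adjoin K (line_entries l)].

Definition O6_step (K K' : set R) : Prop :=
  exists P1 r1 P2 r2 l, [/\ point_over K P1 /\ line_over K r1,
    point_over K P2 /\ line_over K r2,
    O6_fold P1 r1 P2 r2 l & K' = adjoin K (line_entries l)].

Definition degree23_step (K K' : set R) : Prop :=
  field_degree K K' 2 \/ field_degree K K' 3.

Definition fold_step (K K' : set R) : Prop :=
  (field_degree K K' 2 /\ O5_step K K') \/
  (field_degree K K' 3 /\ O6_step K K').

Definition tower (step : set R -> set R -> Prop) (K : set R) : Prop :=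
  exists (r : nat) (T : nat -> set R),
    [/\ T 0%N = QQ R, T r = K & forall i, (i < r)%N -> step (T i) (T i.+1)].

Definition origami_number (x : R) : Prop :=
  exists2 K, tower degree23_step K & K x.

Definition origami_constructible (V : finType) (e : rel V) : Prop :=
  exists2 p, unit_distance_realization e p
    & forall x, coordinates p x -> origami_number x.

End Plane.

Definition vertex21 : finType := ('I_3 * 'Z_7)%type.

(* The pair (i, k) stands for the vertex (r, k) with r = i + 1. *)
Definition arc21 (u v : vertex21) : bool :=
  [|| (u.1 == v.1) && (v.2 == u.2 + (u.1.+1)%:R),
      [&& u.1 == 0, v.1 == 1 & v.2 == u.2 + 1],
      [&& u.1 == 0, v.1 == 2%:R & v.2 == u.2 - 1]
    | [&& u.1 == 1, v.1 == 2%:R & v.2 == u.2 - 2%:R]].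

Definition adj21 : rel vertex21 := [rel u v | arc21 u v || arc21 v u].

Definition kept (v : vertex21) : bool := v \notin [:: (0, 0); (0, 1)].

Definition vertex35 : finType := {v : vertex21 | kept v}.

Definition braced_heptagon : rel vertex35 := [rel u v | adj21 (val u) (val v)].

(* Main.v *)
Require Import Defs.
From mathcomp Require Import ring lra zify.
Import Order.TTheory GRing.Theory Num.Theory.
Set Implicit Arguments.
Unset Strict Implicit.
Unset Printing Implicit Defensive.
Local Open Scope classical_set_scope.
Local Open Scope ring_scope.

(** Write [g = 2 * cos (2 * pi / 7)], a root of [x^3 + x^2 - 2 x - 1] whose
    conjugates are permuted cyclically by [x |-> x^2 - 2] (angle doubling), so
    that [F = Q(g)] is a cyclic cubic field.

    Arithmetic of the angles.  Modulo the cubic, the sextic is [7] times the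
    product of the three conjugates of
    [w^2 + (3 - g^2) w + (11 - 4 g - 6 g^2) / 7], whose discriminant is
    [3 / (2 - g)] ([sextic_factorization]).  The norm of this discriminant is
    [27 / 7], not a rational square, so the discriminant is not a square in [F]
    ([heptic_nonsquare]) and every root of the sextic is quadratic over [F].
    The substitution [w = z + 1 / z] carries the sextic to the polynomial
    satisfied by [zeta], which makes [2 * cos a2] such a root.

    Fields of arbitrary placements.  Adjoin the coordinates to [F] vertex by
    vertex.  A free vertex adjoins the cosine of its angle, quadratic over [F],
    and then a sine, whose square is already present; a triangle vertex adjoins
    one real square root.  Hence each step is trivial or quadratic
    ([fold_field_placed]), a quadratic step is a fold tangent to a parabola
    ([O5_step_sqrt]), and the step from [Q] to [F] is a simultaneous fold
    ([O6_step_heptic]).  Since a free vertex of angle [2 * pi / 7] occurs, [F]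
    lies in the coordinate field ([cos_free_angle]), so nothing is changed by
    starting from [F] rather than from [Q].

    Existence of the realization.  The whole 21-vertex graph, and not only the
    braced heptagon, has a realization invariant under the rotation [om] of
    order 7: the three orbits are the rotated copies of the corners of one
    equilateral triangle of side 1, its [r]-th corner lying at distance
    [rho r = 1 / |om^r - 1| = 1 / (2 * sin (pi * r / 7))] from the centre, so
    that consecutive points of each heptagon are also at distance 1.  A point
    at distances [rho 1], [rho 2], [rho 3] from the vertices of a unit triangle
    exists because [3 (1 + sum rho^4) = (1 + sum rho^2)^2]; both sums equal [2].
    In these coordinates two successive edges of the first orbit have the
    directions required of the first and third free vertices, and a side of the
    triangle has as direction an angle whose doubled cosine is a root of the
    sextic ([root_side12]).  As a vertex at unit distance from two distinct
    placed vertices is automatically one of their two triangle points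
    ([triangle_point_complete]), the order of placement is all that remains to
    be checked. *)

(** * Subfields and quadratic extensions *)

Section Subfields.
Variable R : fieldType.
Implicit Types (K L M A B : set R) (x y : R).

Lemma subfieldP K : is_subfield K <->
  [/\ K 1, forall x y, K x -> K y -> K (x - y)
    & forall x y, K x -> K y -> K (x / y)].
Proof.
split=> [[K1 KB Kd]|[K1 KB Kd]]; split=> [|x y|x y].
- by move: K1; rewrite inE.
- by move=> Kx Ky; have := KB x y; rewrite !inE; apply.
- by move=> Kx Ky; have := Kd x y; rewrite !inE; apply.
- by rewrite inE.
- by rewrite !inE; apply: KB.
- by rewrite !inE; apply: Kd.
Qed.

Section Closure.
Variables (K : set R) (hK : is_subfield K).

Lemma subfield1 : K 1. Proof. by case/subfieldP: hK. Qed.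

Lemma subfieldB x y : K x -> K y -> K (x - y).
Proof. by case/subfieldP: hK => _ h _; apply: h. Qed.

Lemma subfield_div x y : K x -> K y -> K (x / y).
Proof. by case/subfieldP: hK => _ _; apply. Qed.

Lemma subfield0 : K 0.
Proof. by rewrite -(subrr 1); apply: subfieldB; apply: subfield1. Qed.

Lemma subfieldN x : K x -> K (- x).
Proof. by rewrite -sub0r => Kx; apply: subfieldB => //; apply: subfield0. Qed.

Lemma subfieldD x y : K x -> K y -> K (x + y).
Proof.
by move=> Kx Ky; rewrite -(opprK y); apply: subfieldB => //; apply: subfieldN.
Qed.

Lemma subfieldV x : K x -> K x^-1.
Proof.
by move=> Kx; rewrite -div1r; apply: subfield_div => //; apply: subfield1.
Qed.

Lemma subfieldM x y : K x -> K y -> K (x * y).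
Proof.
by move=> Kx Ky; rewrite -(invrK y); apply: subfield_div => //; apply: subfieldV.
Qed.

Lemma subfieldX x n : K x -> K (x ^+ n).
Proof.
move=> Kx; elim: n => [|n IH]; first exact: subfield1.
by rewrite exprS; apply: subfieldM.
Qed.

Lemma subfield_nat n : K n%:R.
Proof.
elim: n => [|n IH]; first exact: subfield0.
by rewrite -natr1; apply: subfieldD => //; apply: subfield1.
Qed.

Lemma subfield_int (n : int) : K n%:~R.
Proof.
by case: n => n; rewrite ?NegzE ?mulrNz; [|apply: subfieldN]; apply: subfield_nat.
Qed.

Lemma subfield_rat (r : rat) : K (ratr r).
Proof. by apply: subfield_div; apply: subfield_int. Qed.

Lemma subfield_sum (I : Type) (r : seq I) (P : pred I) (f : I -> R) :
  (forall i, P i -> K (f i)) -> K (\sum_(i <- r | P i) f i).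
Proof.
move=> Kf; elim/big_ind: _ => //; first exact: subfield0.
exact: subfieldD.
Qed.

End Closure.

End Subfields.

Ltac in_subfield hK := repeat first
  [ assumption | exact: (subfield1 hK) | exact: (subfield0 hK)
  | exact: (subfield_nat hK) | exact: (subfield_rat hK)
  | apply: (subfieldB hK) | apply: (subfieldD hK) | apply: (subfieldN hK)
  | apply: (subfield_div hK) | apply: (subfieldM hK) | apply: (subfieldX hK)
  | apply: (subfieldV hK) ].

Section Extensions.
Variable R : fieldType.
Implicit Types (K L M A B : set R) (x y : R).

Lemma adjoin_subfield K A : is_subfield (adjoin K A).
Proof.
apply/subfieldP; split=> [M [hM _]|x y hx hy M hMA|x y hx hy M hMA].
- exact: subfield1.
- by apply: (subfieldB hMA.1); [apply: hx | apply: hy].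
- by apply: (subfield_div hMA.1); [apply: hx | apply: hy].
Qed.

Lemma sub_adjoin_base K A : K `<=` adjoin K A.
Proof. by move=> x Kx M [_ hM]; apply: hM; left. Qed.

Lemma sub_adjoin K A : A `<=` adjoin K A.
Proof. by move=> x Kx M [_ hM]; apply: hM; right. Qed.

Lemma adjoin_min K A M :
  is_subfield M -> K `<=` M -> A `<=` M -> adjoin K A `<=` M.
Proof. by move=> hM KM AM x; apply; split=> //; rewrite subUset. Qed.

Lemma adjoin_absorb K A : is_subfield K -> A `<=` K -> adjoin K A = K.
Proof.
move=> hK AK; rewrite eqEsubset; split; first exact: adjoin_min.
exact: sub_adjoin_base.
Qed.

Lemma eq_adjoin K A B :
  A `<=` adjoin K B -> B `<=` adjoin K A -> adjoin K A = adjoin K B.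
Proof.
move=> AB BA; rewrite eqEsubset; split; apply: adjoin_min => //;
  by [apply: adjoin_subfield | apply: sub_adjoin_base].
Qed.

Lemma adjoin_adjoin K A B : adjoin (adjoin K A) B = adjoin K (A `|` B).
Proof.
have s1 : A `|` B `<=` adjoin K (A `|` B) by exact: sub_adjoin.
rewrite eqEsubset; split; apply: adjoin_min => //; try exact: adjoin_subfield.
- apply: adjoin_min; [exact: adjoin_subfield | exact: sub_adjoin_base |].
  by move=> x Ax; apply: s1; left.
- by move=> x Bx; apply: s1; right.
- by move=> x Kx; do 2 apply: sub_adjoin_base.
- move=> x [Ax|Bx]; last exact: sub_adjoin.
  by apply: sub_adjoin_base; apply: sub_adjoin.
Qed.

(** The products of the two bases form a basis, indexed through the bijection
    between ['I_m * 'I_n] and ['I_(m * n)]. *)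
Lemma field_degree_mul K L M m n :
  field_degree K L m -> field_degree L M n -> field_degree K M (m * n).
Proof.
case=> hK hL KL [b [Lb spanb freeb]] [_ hM LM [c [Mc spanc freec]]].
split=> //; first by apply: subset_trans LM.
pose T := ('I_m * 'I_n)%type.
have cT : #|{: T}| = (m * n)%N by rewrite card_prod !card_ord.
pose dec (k : 'I_(m * n)) : T := enum_val (cast_ord (esym cT) k).
pose enc (t : T) : 'I_(m * n) := cast_ord cT (enum_rank t).
have encK : cancel enc dec by move=> t; rewrite /dec /enc cast_ordK enum_rankK.
have decK : cancel dec enc by move=> k; rewrite /dec /enc enum_valK cast_ordKV.
have sumE (f : 'I_(m * n) -> R) :
    \sum_k f k = \sum_j \sum_i f (enc (i, j)).
  rewrite (reindex enc) /=; last by exists dec => x _; [exact: encK | exact: decK].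
  by rewrite exchange_big pair_big /=; apply: eq_big => -[i j].
exists (fun k => b (dec k).1 * c (dec k).2); split.
- by move=> k; apply: subfieldM => //; apply: LM.
- move=> x /spanc [d Ld ->].
  have /(_ _)/cid2 ex j := spanb (d j) (Ld j).
  exists (fun k => s2val (ex (dec k).2) (dec k).1) => [k|].
    exact: (s2valP (ex (dec k).2)).
  rewrite sumE; apply: eq_bigr => j _; rewrite {1}(s2valP' (ex j)) mulr_suml.
  by apply: eq_bigr => i _; rewrite encK /= mulrA.
- move=> d Kd; rewrite sumE => d0 k; rewrite -(decK k); case: (dec k) => i j.
  pose e j' := \sum_i d (enc (i, j')) * b i.
  have /freec : forall j', L (e j').
    by move=> j'; apply: subfield_sum => // i' _; apply: subfieldM => //; apply: KL.
  move=> fc; have e0 : forall j', e j' = 0.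
    apply: fc; rewrite -[RHS]d0; apply: eq_bigr => j' _; rewrite mulr_suml.
    by apply: eq_bigr => i' _; rewrite encK /= mulrA.
  exact: (freeb (fun i' => d (enc (i', j))) _ (e0 j)).
Qed.

(** The elements [u + v * x] are closed under inversion because
    [u + v * a - v * x] is the conjugate of [u + v * x] and their product, the
    norm, lies in [K]. *)
Lemma quadratic_degree K x a b : is_subfield K -> K a -> K b -> ~ K x ->
  x ^+ 2 = a * x + b -> field_degree K (adjoin K [set x]) 2.
Proof.
move=> hK Ka Kb nKx xx.
pose M : set R := [set z | exists u v, [/\ K u, K v & z = u + v * x]].
have inM u v : K u -> K v -> M (u + v * x) by exists u, v.
have KM : K `<=` M.
  by move=> u Ku; rewrite -(addr0 u) -(mul0r x); apply: inM; in_subfield hK.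
have Mx : M x.
  by rewrite -(add0r x) -[X in _ + X](mul1r x); apply: inM; in_subfield hK.
have free u v : K u -> K v -> u + v * x = 0 -> u = 0 /\ v = 0.
  move=> Ku Kv e; have [v0|v0] := eqVneq v 0.
    by move: e; rewrite v0 mul0r addr0.
  case: nKx; have -> : x = - u / v.
    apply: (canRL (mulfK v0)); apply/eqP.
    by rewrite -subr_eq0 opprK addrC mulrC e.
  by in_subfield hK.
have hM : is_subfield M.
  have MM z w : M z -> M w -> M (z * w).
    move=> [u [v [Ku Kv ->]]] [u' [v' [Ku' Kv' ->]]].
    have -> : (u + v * x) * (u' + v' * x) =
      u * u' + (u * v' + v * u') * x + v * v' * x ^+ 2 by ring.
    rewrite xx; have -> : u * u' + (u * v' + v * u') * x + v * v' * (a * x + b)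
      = (u * u' + v * v' * b) + (u * v' + v * u' + v * v' * a) * x by ring.
    by apply: inM; in_subfield hK.
  apply/subfieldP; split.
  - by apply: KM; in_subfield hK.
  - move=> _ _ [u [v [Ku Kv ->]]] [u' [v' [Ku' Kv' ->]]].
    have -> : u + v * x - (u' + v' * x) = (u - u') + (v - v') * x by ring.
    by apply: inM; in_subfield hK.
  - move=> z _ Mz [u [v [Ku Kv ->]]]; apply: MM => //.
    have [->|nz] := eqVneq (u + v * x) 0.
      by rewrite invr0; apply: KM; in_subfield hK.
    pose w := u + v * a - v * x.
    pose N := u ^+ 2 + a * u * v - b * v ^+ 2.
    have KN : K N by rewrite /N; in_subfield hK.
    have NE : (u + v * x) * w = N.
      have -> : (u + v * x) * w = u ^+ 2 + a * u * v + v ^+ 2 * (a * x - x ^+ 2).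
        by rewrite /w; ring.
      by rewrite xx /N; ring.
    have w0 : w != 0.
      apply/eqP => w0; have [|||ua /eqP] := free (u + v * a) (- v).
      - by in_subfield hK.
      - by in_subfield hK.
      - by rewrite -w0 /w; ring.
      - rewrite oppr_eq0 => /eqP v0; move: nz ua.
        by rewrite v0 !mul0r !addr0 => /eqP.
    have -> : (u + v * x)^-1 = (u + v * a) / N + (- v / N) * x.
      have -> : (u + v * x)^-1 = w / N by rewrite -NE invfM mulrCA divff // mulr1.
      by rewrite /w; ring.
    by apply: inM; in_subfield hK.
have -> : adjoin K [set x] = M.
  rewrite eqEsubset; split; first by apply: adjoin_min => // _ ->.
  move=> _ [u [v [Ku Kv ->]]].
  have hA := adjoin_subfield K [set x].
  have Ax : adjoin K [set x] x by apply: sub_adjoin.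
  have Au := @sub_adjoin_base K [set x] _ Ku.
  have Av := @sub_adjoin_base K [set x] _ Kv.
  by in_subfield hA.
split=> //; exists (fun i => x ^+ i); split.
- by move=> i; apply: subfieldX.
- move=> _ [u [v [Ku Kv ->]]]; exists (fun i => if i == 0 then u else v).
    by move=> i; case: ifP.
  by rewrite big_ord_recl big_ord1 /= expr0 expr1 mulr1.
- move=> c Kc; rewrite big_ord_recl big_ord1 expr0 expr1 mulr1.
  move=> /(free _ _ (Kc _) (Kc _)) [c0 c1] i.
  have [->|->] // : i = ord0 \/ i = lift ord0 ord0.
  by case: i => [[|[|//]] ?]; [left|right]; apply/val_inj.
Qed.

End Extensions.

(** * Simple extensions of the rationals *)

Lemma QQ_subfield (R : numFieldType) : is_subfield (QQ R).
Proof.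
apply/subfieldP; split.
- by exists 1 => //; rewrite rmorph1.
- by move=> _ _ [a _ <-] [b _ <-]; exists (a - b) => //; rewrite rmorphB.
- by move=> _ _ [a _ <-] [b _ <-]; exists (a / b) => //; rewrite fmorph_div.
Qed.

Definition qeval (R : fieldType) (x : R) (f : {poly rat}) : R :=
  (map_poly ratr f).[x].

Section QEval.
Variables (R : numFieldType) (x : R).

Lemma qevalD f h : qeval x (f + h) = qeval x f + qeval x h.
Proof. by rewrite /qeval rmorphD hornerD. Qed.

Lemma qevalB f h : qeval x (f - h) = qeval x f - qeval x h.
Proof. by rewrite /qeval rmorphB hornerD hornerN. Qed.

Lemma qevalM f h : qeval x (f * h) = qeval x f * qeval x h.
Proof. by rewrite /qeval rmorphM hornerM. Qed.

Lemma qevalC c : qeval x c%:P = ratr c.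
Proof. by rewrite /qeval map_polyC hornerC. Qed.

Lemma qevalX : qeval x 'X = x.
Proof. by rewrite /qeval map_polyX hornerX. Qed.

Lemma qeval1 : qeval x 1 = 1.
Proof. by rewrite /qeval rmorph1 hornerC. Qed.

Lemma qevalE (n : nat) (f : {poly rat}) :
  (size f <= n)%N -> qeval x f = \sum_(i < n) ratr f`_i * x ^+ i.
Proof.
move=> sf; rewrite /qeval (@horner_coef_wide _ n) ?size_map_poly //.
by apply: eq_bigr => i _; rewrite coef_map.
Qed.

Lemma qeval_subfield K f : is_subfield K -> K x -> K (qeval x f).
Proof.
move=> hK Kx; rewrite (qevalE (leqnn _)); apply: (subfield_sum hK) => i _.
by in_subfield hK.
Qed.

End QEval.

Section RationalSimpleExtension.
Variables (R : numFieldType) (q : {poly rat}) (x : R).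
Hypotheses (irr_q : irreducible_poly q) (qx : qeval x q = 0).

Lemma qeval_dvd f : q %| f -> qeval x f = 0.
Proof. by rewrite dvdp_eq => /eqP ->; rewrite qevalM qx mulr0. Qed.

(** An irreducible polynomial not dividing [f] is coprime to [f], and a Bezout
    relation evaluated at [x] inverts the value of [f]. *)
Lemma qeval_inv f : ~~ (q %| f) -> exists h, qeval x h * qeval x f = 1.
Proof.
rewrite -(qpoly.irreducible_poly_coprime _ irr_q).
move=> /Bezout_eq1_coprimepP [u e]; exists u.2.
by rewrite -(qeval1 x) -e qevalD !qevalM qx mulr0 add0r.
Qed.

Lemma qeval_eq0 f : qeval x f = 0 -> q %| f.
Proof.
move=> fx; apply/negPn/negP => /qeval_inv [h /eqP].
by rewrite fx mulr0 eq_sym oner_eq0.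
Qed.

Lemma adjoin_QQE : adjoin (QQ R) [set x] = range (qeval x).
Proof.
rewrite eqEsubset; split; last first.
  move=> _ [f _ <-]; apply: (qeval_subfield _ (adjoin_subfield _ _)).
  by apply: sub_adjoin.
apply: adjoin_min; last by move=> _ ->; exists 'X => //; rewrite qevalX.
- apply/subfieldP; split.
  + by exists 1 => //; rewrite qeval1.
  + by move=> _ _ [f _ <-] [h _ <-]; exists (f - h) => //; rewrite qevalB.
  + move=> _ _ [f _ <-] [h _ <-]; have [qh|/qeval_inv[k kh]] := boolP (q %| h).
      by exists 0 => //; rewrite (qeval_dvd qh) invr0 mulr0 /qeval rmorph0 horner0.
    have h0 : qeval x h != 0.
      by apply: contra_eq_neq kh => ->; rewrite mulr0 eq_sym oner_neq0.
    exists (f * k) => //; rewrite qevalM; congr (_ * _).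
    by apply: (mulIf h0); rewrite kh mulVf.
- by move=> _ [r _ <-]; exists r%:P => //; rewrite qevalC.
Qed.

Lemma simple_degree n :
  size q = n.+1 -> field_degree (QQ R) (adjoin (QQ R) [set x]) n.
Proof.
move=> sq; have q0 := irredp_neq0 irr_q.
have QF := @sub_adjoin_base _ (QQ R) [set x].
have hA := adjoin_subfield (QQ R) [set x].
split=> //; first exact: QQ_subfield.
exists (fun i => x ^+ i); split.
- by move=> i; apply: (subfieldX hA); apply: sub_adjoin.
- rewrite adjoin_QQE => _ [f _ <-].
  exists (fun i => ratr (f %% q)`_i) => [i|]; first by exists (f %% q)`_i.
  rewrite -qevalE; last by rewrite -ltnS -sq ltn_modp.
  by rewrite {1}(divp_eq f q) qevalD qevalM qx mulr0 add0r.
- move=> c Qc c0.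
  have /choice [d dP] : forall i, exists r, ratr r = c i.
    by move=> i; have [r _ <-] := Qc i; exists r.
  pose h := \poly_(i < n) (if insub i is Some j then d j else 0).
  have hE (i : 'I_n) : h`_i = d i by rewrite coef_poly ltn_ord valK.
  have sh : (size h <= n)%N by apply: size_poly.
  have : qeval x h = 0.
    by rewrite (qevalE _ sh) -[RHS]c0; apply: eq_bigr => i _; rewrite hE dP.
  move=> /qeval_eq0 qh i; rewrite -dP -hE.
  have [->|h0] := eqVneq h 0; first by rewrite coef0 rmorph0.
  by have := dvdp_leq h0 qh; rewrite sq ltnNge sh.
Qed.

End RationalSimpleExtension.

Lemma aut_qeval (R : numFieldType) (F : set R) (x : R) t f :
  is_subfield F -> is_aut (QQ R) F t -> F x -> t (qeval x f) = qeval (t x) f.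
Proof.
move=> hF [_ _ tD tM tQ] Fx.
have tR c : t (ratr c) = ratr c by apply: tQ; exists c.
elim/poly_ind: f => [|f c IH].
  by rewrite /qeval !rmorph0 !horner0 -(rmorph0 (@ratr R)) tR.
have FQ := subfield_rat hF c.
have Ff := qeval_subfield f hF Fx.
have Ffx := subfieldM hF Ff Fx.
by rewrite !qevalD !qevalM !qevalX !qevalC tD // tM // IH tR.
Qed.

(** Evaluation at [y] factors through evaluation at [x] because both points
    have the same minimal polynomial. *)
Lemma conjugate_aut (R : numFieldType) (q : {poly rat}) (x y : R)
    (F := adjoin (QQ R) [set x]) :
  irreducible_poly q -> qeval x q = 0 -> qeval y q = 0 ->
  F y -> adjoin (QQ R) [set y] x ->
  exists2 s, is_aut (QQ R) F s & forall f, s (qeval x f) = qeval y f.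
Proof.
move=> irr_q qx qy Fy yx; have hF : is_subfield F by apply: adjoin_subfield.
have FE : F = range (qeval x) by apply: adjoin_QQE irr_q qx.
pose s z := qeval y (xget 0 [set f | qeval x f = z]).
have sE f : s (qeval x f) = qeval y f.
  rewrite /s; case: xgetP => [f' _ /= e|/(_ f)]; last by case.
  have /(qeval_eq0 irr_q qx) : qeval x (f' - f) = 0 by rewrite qevalB e subrr.
  rewrite dvdp_eq => /eqP e'; apply/eqP.
  by rewrite -subr_eq0 -qevalB e' qevalM qy mulr0.
exists s => //; split.
- rewrite {1}FE => _ [f _ <-]; rewrite sE.
  exact: (qeval_subfield f hF Fy).
- move=> z Fz; have : adjoin (QQ R) [set y] z.
    apply: (adjoin_min _ _ _ Fz); [exact: adjoin_subfield| |by move=> _ ->].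
    exact: sub_adjoin_base.
  rewrite (adjoin_QQE irr_q qy) => -[f _ <-].
  by exists (qeval x f) => //; rewrite FE; exists f.
- rewrite FE => _ _ [f _ <-] [h _ <-].
  by rewrite -qevalD !sE qevalD.
- rewrite FE => _ _ [f _ <-] [h _ <-].
  by rewrite -qevalM !sE qevalM.
- by move=> _ [c _ <-]; rewrite -(qevalC x) sE !qevalC.
Qed.

Lemma aut_iter (R : fieldType) (K L : set R) s n :
  is_aut K L s -> is_aut K L (iter n s).
Proof.
move=> [sL sS sD sM sK]; elim: n => [|n [iL iS iD iM iK]].
  by split=> // y Ly; exists y.
split=> [x Lx|y Ly|x y Lx Ly|x y Lx Ly|x Kx] /=.
- exact/sL/iL.
- by have [z Lz <-] := sS y Ly; have [x Lx <-] := iS z Lz; exists x.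
- by rewrite iD // sD //; apply: iL.
- by rewrite iM // sM //; apply: iL.
- by rewrite iK // sK.
Qed.

(** * The cyclic cubic field *)

Definition heptic_cubic : {poly rat} := 'X^3 + 'X^2 - 2%:R *: 'X - 1.

Lemma size_heptic_cubic : size heptic_cubic = 4%N.
Proof.
rewrite /heptic_cubic -!addrA size_polyDl size_polyXn //.
rewrite (leq_ltn_trans (size_polyD _ _)) // gtn_max size_polyXn /=.
rewrite (leq_ltn_trans (size_polyD _ _)) // gtn_max !size_polyN size_poly1.
by rewrite (leq_ltn_trans (size_scale_leq _ _)) // size_polyX.
Qed.

Lemma qeval_heptic_cubic (R : numFieldType) (x : R) :
  qeval x heptic_cubic = x ^+ 3 + x ^+ 2 - 2 * x - 1.
Proof.
rewrite /qeval /heptic_cubic !rmorphB rmorphD /= map_polyZ !map_polyXn map_polyX.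
by rewrite rmorph1 rmorph_nat !hornerE.
Qed.

(** A root in lowest terms [n / d] would give [n^3 + n^2 d - 2 n d^2 - d^3 = 0],
    and modulo 2 this forces both [n] and [d] to be even. *)
Lemma heptic_cubic_irreducible : irreducible_poly heptic_cubic.
Proof.
apply: cubic_irreducible; first by rewrite size_heptic_cubic.
move=> x; apply/negP => /rootP.
have -> : heptic_cubic.[x] = x ^+ 3 + x ^+ 2 - 2 * x - 1.
  by rewrite /heptic_cubic !hornerE.
have d0 : (denq x)%:~R != 0 :> rat by rewrite intr_eq0 denq_neq0.
rewrite -{1 2 3}(divq_num_den x); set n := numq x; set d := denq x => e.
have {e} : n ^+ 3 + n ^+ 2 * d - 2 * n * d ^+ 2 - d ^+ 3 = 0.
  apply: (@intr_inj rat); rewrite !(rmorphXn, rmorphB, rmorphD, rmorphM) /=.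
  rewrite -[RHS](mulr0 (d%:~R ^+ 3)) -e; field.
  by rewrite intr_eq0 denq_neq0.
move=> /(congr1 (fun m : int => m%:~R : 'F_2)) /eqP.
rewrite !(rmorphXn, rmorphB, rmorphD, rmorphM) /= rmorph0.
have F2 (m : int) : (2%:Z %| m)%Z = (m%:~R == 0 :> 'F_2).
  by rewrite -(dvdz_pcharf (pchar_Fp (isT : prime 2))).
have : ~~ ((2%:Z %| n)%Z && (2%:Z %| d)%Z).
  apply/negP; rewrite !dvdzE /= -dvdn_gcd.
  by have := coprime_num_den x; rewrite /coprime => /eqP ->.
rewrite !F2.
by case: (n%:~R) => [[|[|//]] ?] //; case: (d%:~R) => [[|[|//]] ?].
Qed.

(** The exponent of 7 is odd on one side and even on the other. *)
Lemma nonsquare_27_7 (r : rat) : r ^+ 2 * 7 <> 27.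
Proof.
move=> e; have {e} : numq r ^+ 2 * 7 = 27 * denq r ^+ 2.
  apply: (@intr_inj rat); rewrite !(rmorphXn, rmorphM) /= -[27%:~R]e.
  rewrite -{2}(divq_num_den r); field.
  by rewrite intr_eq0 denq_neq0.
move=> /(congr1 absz); rewrite !(abszM, abszX).
change (`|numq r| ^ 2 * 7 = 27 * `|denq r| ^ 2 -> False)%N => e.
have d0 : (0 < `|denq r|)%N by rewrite absz_gt0 denq_neq0.
have n0 : (0 < `|numq r|)%N by case: posnP e => // ->; nia.
move: (congr1 (logn 7) e); rewrite !lognM ?muln_gt0 ?n0 ?d0 //.
by rewrite (_ : logn 7 7 = 1%N) // (_ : logn 7 27 = 0%N) //; lia.
Qed.

(** Angle doubling on the numbers [2 * cos a]; it permutes the roots of the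
    cubic cyclically. *)
Definition tau (R : pzRingType) (x : R) : R := x ^+ 2 - 2.

Lemma heptic_tau (R : comPzRingType) (x : R) :
  x ^+ 3 + x ^+ 2 - 2 * x - 1 = 0 ->
  (tau x) ^+ 3 + (tau x) ^+ 2 - 2 * tau x - 1 = 0.
Proof.
move=> x0; have -> : (tau x) ^+ 3 + (tau x) ^+ 2 - 2 * tau x - 1 =
  (x ^+ 3 + x ^+ 2 - 2 * x - 1) * (x ^+ 3 - x ^+ 2 - 2 * x + 1).
  by rewrite /tau; ring.
by rewrite x0 mul0r.
Qed.

(* In the identities below, as in all later ones, a multiple of the cubic in [g]
   records the quotient of a polynomial division by that cubic. *)

Section HepticField.
Variables (R : numFieldType) (g : R).
Hypothesis g_root : g ^+ 3 + g ^+ 2 - 2 * g - 1 = 0.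

Let F := adjoin (QQ R) [set g].

Lemma tau2 : tau (tau g) = 1 - g - g ^+ 2.
Proof.
apply/eqP; rewrite -subr_eq0.
have -> : tau (tau g) - (1 - g - g ^+ 2) =
  (g ^+ 3 + g ^+ 2 - 2 * g - 1) * (g - 1) by rewrite /tau; ring.
by rewrite g_root mul0r.
Qed.

Lemma tau3 : tau (tau (tau g)) = g.
Proof.
rewrite tau2 /tau; apply/eqP; rewrite -subr_eq0.
have -> : (1 - g - g ^+ 2) ^+ 2 - 2 - g =
  (g ^+ 3 + g ^+ 2 - 2 * g - 1) * (g + 1) by ring.
by rewrite g_root mul0r.
Qed.

Lemma heptic_root_tau (x : R) : x ^+ 3 + x ^+ 2 - 2 * x - 1 = 0 ->
  exists k : nat, x = iter k (@tau R) g.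
Proof.
move=> e; have : (x - g) * (x - tau g) * (x - tau (tau g)) = 0.
  rewrite tau2 /tau.
  have -> : (x - g) * (x - (g ^+ 2 - 2)) * (x - (1 - g - g ^+ 2)) =
    (x ^+ 3 + x ^+ 2 - 2 * x - 1)
    - (g ^+ 3 + g ^+ 2 - 2 * g - 1) * (g * x + 1 - g ^+ 2) by ring.
  by rewrite e g_root mul0r subrr.
move/eqP; rewrite !mulf_eq0 !subr_eq0 -orbA => /or3P[] /eqP ->;
  by [exists 0%N | exists 1%N | exists 2%N].
Qed.

Lemma heptic_degree : field_degree (QQ R) F 3.
Proof.
apply: (simple_degree heptic_cubic_irreducible _ size_heptic_cubic).
by rewrite qeval_heptic_cubic.
Qed.

Lemma adjoin_tau : adjoin (QQ R) [set tau g] = F.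
Proof.
have hF : is_subfield F by apply: adjoin_subfield.
have hT := adjoin_subfield (QQ R) [set tau g].
apply: eq_adjoin => _ ->.
- have Fg : F g by apply: sub_adjoin.
  by rewrite /tau; in_subfield hF.
- have Tg : adjoin (QQ R) [set tau g] (tau g) by apply: sub_adjoin.
  by rewrite -[X in adjoin _ _ X]tau3 {1}/tau {1}/tau; in_subfield hT.
Qed.

Lemma heptic_aut : exists2 s, is_aut (QQ R) F s
  & forall f, s (qeval g f) = qeval (tau g) f.
Proof.
apply: (conjugate_aut heptic_cubic_irreducible);
  rewrite ?qeval_heptic_cubic // ?heptic_tau // ?adjoin_tau.
- by rewrite -/F -adjoin_tau; apply: sub_adjoin.
- exact: sub_adjoin.
Qed.

Lemma tau_qeval (x : R) : tau x = qeval x ('X^2 - 2%:R%:P).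
Proof. by rewrite qevalB qevalC rmorph_nat /qeval map_polyXn hornerXn. Qed.

(** A fixed element is a third of its trace, which is rational because the
    roots of the cubic have sum [- 1] and sum of squares [5]. *)
Lemma heptic_fixed s z : is_aut (QQ R) F s -> s g = tau g -> F z -> s z = z ->
  QQ R z.
Proof.
move=> hs sg; have hF : is_subfield F by apply: adjoin_subfield.
have Fg : F g by apply: sub_adjoin.
have irr := heptic_cubic_irreducible.
have g_root' : qeval g heptic_cubic = 0 by rewrite qeval_heptic_cubic.
have sE f : s (qeval g f) = qeval (tau g) f by rewrite (aut_qeval f hF hs Fg) sg.
have FE : F = range (qeval g) by apply: adjoin_QQE irr g_root'.
rewrite {1}FE => -[f _ <-] sz; have Ftau : F (tau g).
  rewrite tau_qeval; exact: (qeval_subfield _ hF Fg).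
have sz2 : qeval (tau (tau g)) f = qeval g f.
  have : s (s (qeval g f)) = qeval g f by rewrite !sz.
  rewrite (sE f) (aut_qeval f hF hs Ftau) [X in s X]tau_qeval sE.
  by rewrite -tau_qeval.
have : (size (f %% heptic_cubic)%R <= 3)%N.
  by rewrite -ltnS -size_heptic_cubic ltn_modp irredp_neq0.
set h := (_ %% _)%R => sh.
have fE (x : R) : x ^+ 3 + x ^+ 2 - 2 * x - 1 = 0 ->
    qeval x f = ratr h`_0 + ratr h`_1 * x + ratr h`_2 * x ^+ 2.
  rewrite -qeval_heptic_cubic => x0.
  rewrite (divp_eq f heptic_cubic) qevalD qevalM x0 mulr0 add0r (qevalE x sh).
  by rewrite !big_ord_recl big_ord0 addr0 expr0 mulr1 expr1 addrA.
exists (h`_0 - h`_1 / 3 + h`_2 * 5 / 3) => //.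
have : 3 * qeval g f = qeval g f + qeval (tau g) f + qeval (tau (tau g)) f.
  by rewrite sz2 -sE sz; ring.
rewrite (fE _ g_root) (fE _ (heptic_tau g_root)).
rewrite (fE _ (heptic_tau (heptic_tau g_root))) tau2.
set a := ratr h`_0; set b := ratr h`_1; set c := ratr h`_2 => e.
rewrite !(rmorphD, rmorphN, rmorphM, fmorphV, rmorph_nat) /= -/a -/b -/c.
apply: (@mulfI _ 3) => //; rewrite e.
have -> : a + b * g + c * g ^+ 2 + (a + b * tau g + c * tau g ^+ 2)
    + (a + b * (1 - g - g ^+ 2) + c * (1 - g - g ^+ 2) ^+ 2)
  = 3 * a - b + c * (5 + 2 * g * (g ^+ 3 + g ^+ 2 - 2 * g - 1)).
  by rewrite /tau; ring.
by rewrite g_root; field.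
Qed.

Lemma aut_iter_tau s k : is_aut (QQ R) F s -> s g = tau g ->
  iter k s g = iter k (@tau R) g.
Proof.
move=> hs sg; have hF : is_subfield F by apply: adjoin_subfield.
have Fg : F g by apply: sub_adjoin.
elim: k => // k IH.
rewrite [LHS]iterSr sg [X in iter k s X]tau_qeval.
by rewrite (aut_qeval _ hF (aut_iter k hs) Fg) IH -tau_qeval.
Qed.

(** An automorphism is determined by the image of [g], another root of the
    cubic, hence an iterate of [tau] at [g]. *)
Lemma heptic_cyclic : cyclic_extension (QQ R) F 3.
Proof.
have [s hs sE] := heptic_aut; have irr := heptic_cubic_irreducible.
have hF : is_subfield F by apply: adjoin_subfield.
have Fg : F g by apply: sub_adjoin.
have sg : s g = tau g by rewrite -{1}(qevalX g) sE qevalX.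
have g_root' : qeval g heptic_cubic = 0 by rewrite qeval_heptic_cubic.
have FE : F = range (qeval g) by apply: adjoin_QQE irr g_root'.
split; first exact: heptic_degree.
  by move=> z Fz /(_ _ hs); apply: heptic_fixed hs sg Fz.
exists s => // t ht.
have [m tg] : exists m, t g = iter m (@tau R) g.
  apply: heptic_root_tau; rewrite -qeval_heptic_cubic -(aut_qeval _ hF ht Fg).
  by rewrite g_root' -(rmorph0 (@ratr R)); case: ht => _ _ _ _; apply; exists 0.
exists m; rewrite {1}FE => _ [f _ <-].
rewrite (aut_qeval _ hF ht Fg) (aut_qeval _ hF (aut_iter m hs) Fg) tg.
by rewrite (aut_iter_tau _ hs sg).
Qed.

(** Taking norms from [F] to the rationals, [u ^+ 2 = 3 / (2 - g)] would make
    [27 / 7] a rational square. *)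
Lemma heptic_nonsquare u : F u -> u ^+ 2 * (2 - g) <> 3.
Proof.
have irr := heptic_cubic_irreducible.
have hF : is_subfield F by apply: adjoin_subfield.
have Fg : F g by apply: sub_adjoin.
have g_root' : qeval g heptic_cubic = 0 by rewrite qeval_heptic_cubic.
have FE : F = range (qeval g) by apply: adjoin_QQE irr g_root'.
have [s hs sE] := heptic_aut.
have sg : s g = tau g by rewrite -{1}(qevalX g) sE qevalX.
rewrite {1}FE => -[f _ <-] e.
have conj_eq (x : R) : x ^+ 3 + x ^+ 2 - 2 * x - 1 = 0 -> qeval x f ^+ 2 * (2 - x) = 3.
  rewrite -qeval_heptic_cubic => x0; apply/eqP; rewrite -subr_eq0.
  have rel (z : R) : qeval z f ^+ 2 * (2 - z) - 3 =
      qeval z (f * f * (2%:R%:P - 'X) - 3%:R%:P).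
    by rewrite !(qevalB, qevalM) !qevalC !rmorph_nat qevalX.
  by rewrite rel (qeval_dvd x0) // (qeval_eq0 irr g_root') // -rel e subrr.
have itE k : iter k s (qeval g f) = qeval (iter k (@tau R) g) f.
  by rewrite (aut_qeval f hF (aut_iter k hs) Fg) (aut_iter_tau _ hs sg).
pose y k := iter k s (qeval g f).
have Fy k : F (y k).
  by case: (aut_iter k hs) => sF _ _ _ _; exact: (sF _ (qeval_subfield f hF Fg)).
have [r _ rE] : QQ R (y 0%N * y 1%N * y 2%N).
  have Fyy := subfieldM hF (Fy 0%N) (Fy 1%N).
  apply: (heptic_fixed hs sg); first exact: (subfieldM hF Fyy (Fy 2%N)).
  have [_ _ _ sM _] := hs; rewrite !sM //.
  rewrite -[s (y 2%N)]/(y 3%N) [y 3%N]itE /= tau3.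
  by rewrite -[s (y 0%N)]/(y 1%N) -[s (y 1%N)]/(y 2%N) mulrC mulrA.
apply: (@nonsquare_27_7 r); apply: (fmorph_inj (@ratr R)).
rewrite !(rmorphM, rmorphXn) /= rE !rmorph_nat.
have e0 := conj_eq _ g_root.
have e1 := conj_eq _ (heptic_tau g_root).
have e2 := conj_eq _ (heptic_tau (heptic_tau g_root)).
have -> : 7 = (2 - g) * (2 - tau g) * (2 - tau (tau g)) :> R.
  rewrite tau2 /tau; apply/eqP; rewrite -subr_eq0.
  have -> : 7 - (2 - g) * (2 - (g ^+ 2 - 2)) * (2 - (1 - g - g ^+ 2)) =
    (g ^+ 3 + g ^+ 2 - 2 * g - 1) * (1 + 2 * g - g ^+ 2) by ring.
  by rewrite g_root mul0r.
rewrite [y 0%N]itE [y 1%N]itE [y 2%N]itE /=.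
transitivity ((qeval g f ^+ 2 * (2 - g)) *
  (qeval (tau g) f ^+ 2 * (2 - tau g)) *
  (qeval (tau (tau g)) f ^+ 2 * (2 - tau (tau g)))); first by ring.
by rewrite e0 e1 e2 -!natrM.
Qed.

End HepticField.

Lemma adjoin_iter_tau (R : numFieldType) (g : R) k :
  g ^+ 3 + g ^+ 2 - 2 * g - 1 = 0 ->
  adjoin (QQ R) [set iter k (@tau R) g] = adjoin (QQ R) [set g].
Proof.
elim: k g => // k IH g g_root.
by rewrite iterSr IH ?adjoin_tau //; apply: heptic_tau.
Qed.

(** * The sextic and its quadratic factors *)

Definition monic_quadratic (R : nzRingType) (b c : R) : {poly R} :=
  'X^2 + b *: 'X + c%:P.

Definition factor_lin : {poly rat} := 3%:R%:P - 'X^2.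
Definition factor_const : {poly rat} :=
  (1 / 7)%:P * (11%:R%:P - 4%:R%:P * 'X - 6%:R%:P * 'X^2).

(** The quadratic factor of the sextic attached to the conjugate [x] of
    [2 * cos (2 * pi / 7)]; its discriminant is [3 / (2 - x)]. *)
Definition sextic_factor (R : fieldType) (x : R) : {poly R} :=
  monic_quadratic (qeval x factor_lin) (qeval x factor_const).

Section MonicQuadratic.
Variable R : comNzRingType.
Implicit Types b c : R.

Lemma size_monic_quadratic b c : size (monic_quadratic b c) = 3%N.
Proof.
rewrite /monic_quadratic -addrA size_polyDl size_polyXn //.
rewrite (leq_ltn_trans (size_polyD _ _)) // gtn_max.
rewrite (leq_ltn_trans (size_scale_leq _ _)) ?size_polyX //.
by rewrite (leq_ltn_trans (size_polyC_leq1 _)).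
Qed.

Lemma monic_monic_quadratic b c : monic_quadratic b c \is monic.
Proof.
rewrite monicE /lead_coef size_monic_quadratic /monic_quadratic.
by rewrite !coefE /= mulr0 !addr0.
Qed.

Lemma coef_monic_quadratic b c i :
  (monic_quadratic b c)`_i = nth 0 [:: c; b; 1] i.
Proof.
rewrite /monic_quadratic !coefE; case: i => [|[|[|i]]] /=;
  by rewrite ?mulr0 ?mulr1 ?addr0 ?add0r ?nth_nil.
Qed.

Lemma mul_monic_quadratic3 b0 c0 b1 c1 b2 c2 :
  monic_quadratic b0 c0 * monic_quadratic b1 c1 * monic_quadratic b2 c2 =
  'X^6 + (b0 + b1 + b2) *: 'X^5
  + (c0 + c1 + c2 + b0 * b1 + b0 * b2 + b1 * b2) *: 'X^4
  + (b0 * b1 * b2 + c0 * (b1 + b2) + c1 * (b0 + b2) + c2 * (b0 + b1)) *: 'X^3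
  + (c0 * c1 + c0 * c2 + c1 * c2 + c0 * b1 * b2 + c1 * b0 * b2 + c2 * b0 * b1)
    *: 'X^2
  + (b0 * c1 * c2 + b1 * c0 * c2 + b2 * c0 * c1) *: 'X + (c0 * c1 * c2)%:P.
Proof.
by rewrite /monic_quadratic -!mul_polyC !(rmorphD, rmorphM) /=; ring.
Qed.

End MonicQuadratic.

Section SexticFactors.
Variables (R : numFieldType) (g : R).
Hypothesis g_root : g ^+ 3 + g ^+ 2 - 2 * g - 1 = 0.
Let F := adjoin (QQ R) [set g].

Lemma qeval_factor_lin (x : R) : qeval x factor_lin = 3 - x ^+ 2.
Proof. by rewrite qevalB qevalC rmorph_nat /qeval map_polyXn hornerXn. Qed.

Lemma qeval_factor_const (x : R) :
  qeval x factor_const = (11 - 4 * x - 6 * x ^+ 2) / 7.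
Proof.
rewrite qevalM !qevalB !qevalM !qevalX !qevalC.
by rewrite fmorph_div !rmorph_nat; field.
Qed.

(** Each coefficient of the product is a symmetric function of the three
    conjugates, hence rational. *)
Lemma sextic_factorization :
  sextic R = 7%:R *: (sextic_factor g * sextic_factor (tau g)
                      * sextic_factor (tau (tau g))).
Proof.
rewrite mul_monic_quadratic3 !qeval_factor_lin !qeval_factor_const.
rewrite (tau2 g_root) /tau.
set b0 := 3 - g ^+ 2; set b1 := 3 - _ ^+ 2; set b2 := 3 - _ ^+ 2.
set c0 := _ / 7; set c1 := _ / 7; set c2 := _ / 7.
have e5 : b0 + b1 + b2 = 4.
  transitivity (4 + (g ^+ 3 + g ^+ 2 - 2 * g - 1) * (- 2 * g)); last first.
    by rewrite g_root; ring.
  by rewrite /b0 /b1 /b2; ring.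
have e4 : c0 + c1 + c2 + b0 * b1 + b0 * b2 + b1 * b2 = 4.
  transitivity (4 + (g ^+ 3 + g ^+ 2 - 2 * g - 1) * (2 - 68 / 7 * g - 3 * g ^+ 2
    - 2 * g ^+ 3 + g ^+ 4 + g ^+ 5)); last by rewrite g_root; ring.
  by rewrite /b0 /b1 /b2 /c0 /c1 /c2; field.
have e3 : b0 * b1 * b2 + c0 * (b1 + b2) + c1 * (b0 + b2) + c2 * (b0 + b1) = - 1.
  transitivity (- 1 + (g ^+ 3 + g ^+ 2 - 2 * g - 1) * (47 / 7 - 92 / 7 * g
    - 94 / 7 * g ^+ 2 - 101 / 7 * g ^+ 3 + 54 / 7 * g ^+ 4 + 61 / 7 * g ^+ 5
    - g ^+ 6 - g ^+ 7)); last by rewrite g_root; ring.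
  by rewrite /b0 /b1 /b2 /c0 /c1 /c2; field.
have e2 : c0 * c1 + c0 * c2 + c1 * c2 + c0 * b1 * b2 + c1 * b0 * b2
    + c2 * b0 * b1 = - 2.
  transitivity (- 2 + (g ^+ 3 + g ^+ 2 - 2 * g - 1) * (48 / 7 - 20 / 7 * g
    - 1009 / 49 * g ^+ 2 - 1304 / 49 * g ^+ 3 + 827 / 49 * g ^+ 4
    + 841 / 49 * g ^+ 5 - 22 / 7 * g ^+ 6 - 18 / 7 * g ^+ 7));
    last by rewrite g_root; ring.
  by rewrite /b0 /b1 /b2 /c0 /c1 /c2; field.
have e1 : b0 * c1 * c2 + b1 * c0 * c2 + b2 * c0 * c1 = 0.
  transitivity ((g ^+ 3 + g ^+ 2 - 2 * g - 1) * (136 / 49 + 30 / 7 * g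
    - 688 / 49 * g ^+ 2 - 132 / 7 * g ^+ 3 + 708 / 49 * g ^+ 4
    + 624 / 49 * g ^+ 5 - 156 / 49 * g ^+ 6 - 108 / 49 * g ^+ 7));
    last by rewrite g_root; ring.
  by rewrite /b0 /b1 /b2 /c0 /c1 /c2; field.
have e0 : c0 * c1 * c2 = 1 / 7.
  transitivity (1 / 7 + (g ^+ 3 + g ^+ 2 - 2 * g - 1) * (104 / 343
    + 652 / 343 * g - 1220 / 343 * g ^+ 2 - 1584 / 343 * g ^+ 3
    + 1476 / 343 * g ^+ 4 + 1116 / 343 * g ^+ 5 - 360 / 343 * g ^+ 6
    - 216 / 343 * g ^+ 7)); last by rewrite g_root; ring.
  by rewrite /c0 /c1 /c2; field.
rewrite e5 e4 e3 e2 e1 e0 /sextic !scalerDr !scalerA mulr0 scale0r addr0.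
rewrite -[7%:R *: (1 / 7)%:P]mul_polyC -polyCM mulrCA divff ?pnatr_eq0 // mulr1.
by rewrite !mulrN mulr1 !scaleNr -!natrM.
Qed.

Lemma sextic_rootP (w : R) : root (sextic R) w ->
  exists k : nat, root (sextic_factor (iter k (@tau R) g)) w.
Proof.
rewrite sextic_factorization rootZ ?pnatr_eq0 // !rootM -orbA.
by case/or3P; [exists 0%N | exists 1%N | exists 2%N].
Qed.

Lemma iter_tau_in k : F (iter k (@tau R) g).
Proof.
have hF : is_subfield F by apply: adjoin_subfield.
elim: k => [|k IH]; first exact: sub_adjoin.
by rewrite iterS tau_qeval; apply: (qeval_subfield _ hF IH).
Qed.

Lemma iter_tau_root k : let x := iter k (@tau R) g in
  x ^+ 3 + x ^+ 2 - 2 * x - 1 = 0.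
Proof. by elim: k => //= k; apply: heptic_tau. Qed.

Lemma root_sextic_factor (x w : R) :
  root (sextic_factor x) w =
  (w ^+ 2 + (3 - x ^+ 2) * w + (11 - 4 * x - 6 * x ^+ 2) / 7 == 0).
Proof.
rewrite rootE /sextic_factor /monic_quadratic !hornerD hornerZ hornerXn hornerX.
by rewrite hornerC qeval_factor_lin qeval_factor_const.
Qed.

Lemma sextic_root_quadratic (w : R) : root (sextic R) w ->
  exists a b, [/\ F a, F b & w ^+ 2 = a * w + b].
Proof.
have hF : is_subfield F by apply: adjoin_subfield.
move=> /sextic_rootP[k]; have Fx := iter_tau_in k.
set x := iter _ _ _ in Fx *; rewrite root_sextic_factor => /eqP e.
exists (- (3 - x ^+ 2)), (- ((11 - 4 * x - 6 * x ^+ 2) / 7)); split.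
- by in_subfield hF.
- by in_subfield hF.
- by rewrite -[LHS]subr0 -e; ring.
Qed.

(** If [w] were in [F], so would be the square root [2 * w + 3 - x ^+ 2] of the
    discriminant. *)
Lemma sextic_root_notin (w : R) : root (sextic R) w -> ~ F w.
Proof.
move=> /sextic_rootP[k]; rewrite root_sextic_factor => /eqP.
have := iter_tau_root k; have := iter_tau_in k.
have := adjoin_iter_tau k g_root; rewrite -/F.
set x := iter _ _ _ => Fx xF x_root e Fw.
have hF : is_subfield F by apply: adjoin_subfield.
apply: (@heptic_nonsquare _ x x_root (2 * w + 3 - x ^+ 2)).
  by rewrite Fx; in_subfield hF.
transitivity (4 * (2 - x) * (w ^+ 2 + (3 - x ^+ 2) * w
    + (11 - 4 * x - 6 * x ^+ 2) / 7)
  + (x ^+ 3 + x ^+ 2 - 2 * x - 1) * (3 * x - x ^+ 2 - 17 / 7) + 3).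
  by field.
by rewrite e x_root; ring.
Qed.

Lemma sextic_factor_coefs k : coefs_in F (sextic_factor (iter k (@tau R) g)).
Proof.
have hF : is_subfield F by apply: adjoin_subfield.
move=> i; rewrite coef_monic_quadratic; have Fx := iter_tau_in k.
case: i => [|[|[|i]]] /=; rewrite ?nth_nil; in_subfield hF;
  exact: (qeval_subfield _ hF Fx).
Qed.

Lemma map_sextic_factor s (x : R) : is_aut (QQ R) F s -> F x ->
  map_poly s (sextic_factor x) = sextic_factor (s x).
Proof.
move=> hs Fx; have hF : is_subfield F by apply: adjoin_subfield.
have sQ c : s (ratr c) = ratr c by case: hs => _ _ _ _; apply; exists c.
have s0 : s 0 = 0 by rewrite -(rmorph0 (@ratr R)) sQ.
have s1 : s 1 = 1 by rewrite -(rmorph1 (@ratr R)) sQ.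
apply/polyP => i; rewrite coef_map_id0 // !coef_monic_quadratic.
by case: i => [|[|[|i]]] //=; rewrite ?nth_nil // (aut_qeval _ hF hs Fx).
Qed.

End SexticFactors.

(** * The angles *)

Lemma horner_sextic (R : comNzRingType) (w : R) : (sextic R).[w] =
  7 * w ^+ 6 + 28 * w ^+ 5 + 28 * w ^+ 4 - 7 * w ^+ 3 - 14 * w ^+ 2 + 1.
Proof. by rewrite /sextic !(hornerD, hornerN, hornerZ, hornerXn, hornerC). Qed.

Lemma horner_zeta_poly (R : fieldType) (z : R) : z != 0 ->
  (zeta_poly R).[z] = z ^+ 6 * (sextic R).[z + z^-1].
Proof.
move=> z0; rewrite horner_sextic /zeta_poly.
rewrite !(hornerD, hornerN, hornerZ, hornerXn, hornerX, hornerC).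
by field.
Qed.

Section Trigonometry.
Variable R : realType.
Local Notation theta := (2 * pi / 7 : R).
Local Notation g := (2 * cos theta : R).

Lemma heptic_theta_bounds : 0 < theta < pi / 2.
Proof.
have := pi_gt0 R; move=> p0; apply/andP; split; lra.
Qed.

(** [cos (3 * theta) = cos (4 * theta)] gives a quartic in [g], of which
    [2] is the other rational root. *)
Lemma heptic_cos_root : g ^+ 3 + g ^+ 2 - 2 * g - 1 = 0.
Proof.
have t2 : 2 * theta = theta + theta by ring.
have c2 : cos (2 * theta) = 2 * cos theta ^+ 2 - 1.
  rewrite t2 cosD -!expr2 -(addKr (cos theta ^+ 2) (sin theta ^+ 2)) cos2Dsin2.
  by ring.
have c3 : cos (3 * theta) = 4 * cos theta ^+ 3 - 3 * cos theta.
  have -> : 3 * theta = 2 * theta + theta by ring.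
  rewrite cosD c2 t2 sinD; have := cos2Dsin2 theta.
  set c := cos _; set s := sin _ => e.
  transitivity ((2 * c ^+ 2 - 1) * c - 2 * c * s ^+ 2); first by ring.
  by rewrite -[s ^+ 2](addKr (c ^+ 2)) e; ring.
have c4 : cos (4 * theta) = 2 * cos (2 * theta) ^+ 2 - 1.
  have -> : 4 * theta = 2 * theta + 2 * theta by ring.
  rewrite cosD -!expr2.
  rewrite -(addKr (cos (2 * theta) ^+ 2) (sin (2 * theta) ^+ 2)) cos2Dsin2.
  by ring.
have e : cos (3 * theta) = cos (4 * theta).
  have -> : 4 * theta = - (3 * theta) + pi *+ 2 by field.
  by rewrite cosD2pi cosN.
have : (g - 2) * (g ^+ 3 + g ^+ 2 - 2 * g - 1) = 0.
  have : 2 * cos (4 * theta) - 2 * cos (3 * theta) = 0 by rewrite e subrr.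
  by rewrite c4 c3 c2 => e'; rewrite -[RHS]e'; ring.
move/eqP; rewrite mulf_eq0 subr_eq0 => /orP[/eqP g2|/eqP //].
have /andP[t0 t1] := heptic_theta_bounds.
have : cos theta < 1.
  have p0 := pi_gt0 R.
  rewrite -[ltRHS]cos0 ltr_cos ?in_itv //=; try (apply/andP; split); lra.
by rewrite -(ltr_pM2l (ltr0n R 2)) g2 mulr1 ltxx.
Qed.

Lemma F7E : F7 R = adjoin (QQ R) [set g].
Proof.
have h1 := adjoin_subfield (QQ R) [set g].
have h2 := adjoin_subfield (QQ R) [set cos theta].
apply: eq_adjoin => _ ->.
- have cE : cos theta = g / 2 by field.
  rewrite [X in adjoin _ _ X]cE.
  have Fg : adjoin (QQ R) [set g] g by apply: sub_adjoin.
  by in_subfield h1.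
- have Fc : adjoin (QQ R) [set cos theta] (cos theta) by apply: sub_adjoin.
  by in_subfield h2.
Qed.

Section UnitComplex.
Variables x y : R.
Hypothesis xy : x ^+ 2 + y ^+ 2 = 1.
Let z : R[i] := (x +i* y)%C.

Lemma unit_complex_inv : z^-1 = (x -i* y)%C.
Proof.
have e : z * (x -i* y)%C = 1.
  apply/eqP; rewrite eq_complex /= mulrN opprK -!expr2 xy eqxx /=.
  by apply/eqP; ring.
have z0 : z != 0 by apply: contra_eq_neq e => ->; rewrite mul0r eq_sym oner_neq0.
by rewrite -[RHS](mulKf z0) e mulr1.
Qed.

(** On the unit circle [z + z^-1] is twice the real part of [z]. *)
Lemma root_zeta_poly_unit : root (zeta_poly R[i]) z = root (sextic R) (2 * x).
Proof.
have z0 : z != 0.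
  apply/eqP => /eqP; rewrite eq_complex /= => /andP[/eqP x0 /eqP y0].
  by move: xy; rewrite x0 y0 expr0n addr0 => /eqP; rewrite eq_sym oner_eq0.
rewrite !rootE horner_zeta_poly // mulf_eq0 expf_eq0 (negPf z0) /=.
have -> : z + z^-1 = (2 * x)%:C%C.
  rewrite unit_complex_inv; apply/eqP; rewrite eq_complex /= subrr eqxx andbT.
  by apply/eqP; ring.
rewrite -(inj_eq (@complexI R)) rmorph0 !horner_sextic.
by rewrite !(rmorph_nat, rmorph1, rmorphXn, rmorphB, rmorphD, rmorphM).
Qed.

End UnitComplex.

Lemma zeta_angle_sextic (zeta : R[i]) (a : R) :
  is_zeta_angle zeta a -> root (sextic R) (2 * cos a).
Proof.
case=> _ rz _ ez; rewrite -(root_zeta_poly_unit (cos2Dsin2 a)).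
by rewrite -ez.
Qed.

Lemma zeta_angle_exists (x y : R) : x ^+ 2 + y ^+ 2 = 1 ->
  root (sextic R) (2 * x) ->
  exists a, [/\ is_zeta_angle (x +i* y)%C a, cos a = x & sin a = y].
Proof.
move=> xy rx.
have x1 : -1 <= x <= 1.
  by apply/andP; split; nra.
have [a [a1 ca sa]] : exists a, [/\ - pi < a <= pi, cos a = x & sin a = y].
  have ca : cos (acos x) = x by rewrite acosK // in_itv.
  have sa : sin (acos x) = `|y|.
    by rewrite sin_acos // -(sqrtr_sqr y) -xy addrAC subrr add0r.
  have p0 := pi_gt0 R; have a0 := acos_ge0 x1; have ap := acos_lepi x1.
  case: (lerP 0 y) => y0.
    exists (acos x); rewrite ca sa ger0_norm //; split=> //.
    by apply/andP; split=> //; lra.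
  have xlt : -1 < x <= 1 by case/andP: x1 => ? ->; rewrite andbT; nra.
  have ap' := acos_ltpi xlt.
  exists (- acos x); rewrite cosN sinN ca sa ltr0_norm // opprK; split=> //.
  by apply/andP; split; lra.
exists a; split=> //; split=> //; last by rewrite ca sa.
  by rewrite normc_def /= xy sqrtr1.
by rewrite root_zeta_poly_unit.
Qed.

End Trigonometry.

(** * Folds and towers *)

Section Folds.
Variable R : realType.
Implicit Types (K F : set R) (x d : R).

Lemma tower_rcons (step : set R -> set R -> Prop) K L :
  tower step K -> step K L -> tower step L.
Proof.
move=> [r [T [T0 Tr Ts]]] KL.
exists r.+1, (fun i => if (i <= r)%N then T i else L); split => //.
  by rewrite ltnn.
move=> i; rewrite ltnS {1}leq_eqVlt => /predU1P[->|ir].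
  by rewrite leqnn ltnn Tr.
by rewrite (ltnW ir) ir; apply: Ts.
Qed.

Lemma tower_sub (s1 s2 : set R -> set R -> Prop) K :
  (forall A B, s1 A B -> s2 A B) -> tower s1 K -> tower s2 K.
Proof. by move=> s12 [r [T [T0 Tr Ts]]]; exists r, T; split=> // i /Ts/s12. Qed.

(** The creases folding the focus [(0, 1)] onto the directrix [y = - 1] are the
    tangents [y = m * x - m ^+ 2] of a parabola; the one through [(0, - m ^+ 2)]
    has slope [m]. *)
Lemma O5_step_sqrt K x : is_subfield K -> K (x ^+ 2) ->
  O5_step K (adjoin K [set x]).
Proof.
move=> hK Kd; have K0 := subfield0 hK; have K1 := subfield1 hK.
exists (0, 1), (Oblique 0 (- 1)), (0, - x ^+ 2), (Oblique x (- x ^+ 2)).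
have n0 : x ^+ 2 + 1 != 0 by rewrite gt_eqF // ltr_wpDl // sqr_ge0.
split=> //=.
- by move=> _ [->|->] //; in_subfield hK.
- by split=> //; in_subfield hK.
- split=> /=.
  + by rewrite mulr0 add0r => /eqP; rewrite eq_sym eqNr oner_eq0.
  + by rewrite mulr0 add0r.
  + by field.
- have hA := adjoin_subfield K [set x].
  apply: eq_adjoin => y; first by move=> ->; apply: sub_adjoin; left.
  case=> ->; first exact: sub_adjoin.
  by apply: (subfieldN hA); apply: sub_adjoin_base.
Qed.

(** Adding the fold of [(- 2, - 2)] onto the axis [x = 0] to the same parabola
    leaves the cubic condition [m ^+ 3 + m ^+ 2 - 2 * m - 1 = 0] on the slope. *)
Lemma O6_step_heptic (g : R) : g ^+ 3 + g ^+ 2 - 2 * g - 1 = 0 ->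
  O6_step (QQ R) (adjoin (QQ R) [set g]).
Proof.
move=> g_root; have hK := QQ_subfield R.
have n0 : g ^+ 2 + 1 != 0 by rewrite gt_eqF // ltr_wpDl // sqr_ge0.
exists (0, 1), (Oblique 0 (- 1)), (- 2, - 2), (Vertical 0), (Oblique g (- g ^+ 2)).
split=> //=.
- split; first by split; in_subfield hK.
  by move=> _ [->|->] //; in_subfield hK.
- split; first by split; in_subfield hK.
  by move=> _ ->; in_subfield hK.
- split=> //=.
  + by rewrite mulr0 add0r => /eqP; rewrite eq_sym eqNr oner_eq0.
  + by apply/eqP; rewrite oppr_eq0 pnatr_eq0.
  + by field.
  + transitivity (2 * (g ^+ 3 + g ^+ 2 - 2 * g - 1) / (g ^+ 2 + 1)); last first.
      by rewrite g_root mulr0 mul0r.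
    by field.
- have hA := adjoin_subfield (QQ R) [set g].
  have Ag : adjoin (QQ R) [set g] g by apply: sub_adjoin.
  apply: eq_adjoin => y; first by move=> ->; apply: sub_adjoin; left.
  by case=> ->; in_subfield hA.
Qed.

(** The property of fields that is carried along a placement. *)
Definition fold_field K :=
  tower (@fold_step R) K /\ exists k : nat, field_degree (QQ R) K (3 * 2 ^ k).

Lemma fold_field_subfield K : fold_field K -> is_subfield K.
Proof. by case=> _ [k []]. Qed.

Lemma fold_field_heptic (g : R) : g ^+ 3 + g ^+ 2 - 2 * g - 1 = 0 ->
  fold_field (adjoin (QQ R) [set g]).
Proof.
move=> g_root; have d3 := heptic_degree g_root.
split; last by exists 0%N; rewrite muln1.
apply: (@tower_rcons _ (QQ R)).
  by exists 0%N, (fun=> QQ R).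
by right; split=> //; apply: O6_step_heptic.
Qed.

Lemma fold_field_quadratic K x a b : fold_field K -> K a -> K b ->
  x ^+ 2 = a * x + b -> fold_field (adjoin K [set x]).
Proof.
move=> fK Ka Kb xx; have hK := fold_field_subfield fK.
have [Kx|nKx] := pselect (K x).
  by rewrite adjoin_absorb // => _ ->.
(* completing the square *)
pose u := x - a / 2.
have uu : u ^+ 2 = a ^+ 2 / 4 + b.
  transitivity (x ^+ 2 - a * x + a ^+ 2 / 4); first by rewrite /u; field.
  by rewrite xx; ring.
have Kuu : K (u ^+ 2) by rewrite uu; in_subfield hK.
have xE : x = u + a / 2 by rewrite /u; ring.
have nKu : ~ K u by move=> Ku; apply: nKx; rewrite xE; in_subfield hK.
have -> : adjoin K [set x] = adjoin K [set u].
  have h1 := adjoin_subfield K [set u]; have h2 := adjoin_subfield K [set x].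
  have a1 := @sub_adjoin_base _ K [set u] _ Ka.
  have a2 := @sub_adjoin_base _ K [set x] _ Ka.
  have u1 : adjoin K [set u] u by apply: sub_adjoin.
  have x1 : adjoin K [set x] x by apply: sub_adjoin.
  apply: eq_adjoin => _ ->; first by rewrite [X in adjoin _ _ X]xE; in_subfield h1.
  by rewrite /u; in_subfield h2.
have d2 : field_degree K (adjoin K [set u]) 2.
  apply: (@quadratic_degree _ K u 0 (u ^+ 2)) => //; first exact: subfield0.
  by rewrite mul0r add0r.
case: fK => tK [k dk]; split.
  by apply: (tower_rcons tK); left; split=> //; apply: O5_step_sqrt.
by exists k.+1; rewrite expnSr mulnA; apply: field_degree_mul dk d2.
Qed.

Lemma fold_field_sqrt K x : fold_field K -> K (x ^+ 2) -> fold_field (adjoin K [set x]).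
Proof.
move=> fK Kx; have hK := fold_field_subfield fK.
by apply: (fold_field_quadratic fK (subfield0 hK) Kx); rewrite mul0r add0r.
Qed.

Lemma fold_field_origami K x : fold_field K -> K x -> origami_number x.
Proof.
case=> tK _ Kx; exists K => //; apply: tower_sub tK => A B.
by case=> -[d _]; [left | right].
Qed.

End Folds.

(** * Coordinate fields of placements *)

Section PlacementFields.
Variables (R : realType) (V : finType) (e : rel V) (p : V -> R * R).
Implicit Types (s : seq V) (K F : set R).

Definition coordinates_on s : set R :=
  [set x | exists2 v, v \in s & x = (p v).1 \/ x = (p v).2].

Lemma coordinates_on_cons F v s :
  adjoin F (coordinates_on (v :: s)) =
  adjoin (adjoin F (coordinates_on s)) [set (p v).1; (p v).2].
Proof.
rewrite adjoin_adjoin; congr adjoin; apply/seteqP; split=> x.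
  move=> [w]; rewrite inE => /predU1P[->|ws] xw; first by right; case: xw; [left|right].
  by left; exists w.
move=> [[w ws xw]|[->|->]]; first by exists w => //; rewrite inE ws orbT.
  by exists v; [rewrite mem_head | left].
by exists v; [rewrite mem_head | right].
Qed.

Lemma adjoin_coordinates F v s : v \in s ->
  let K := adjoin F (coordinates_on s) in K (p v).1 /\ K (p v).2.
Proof.
by move=> vs; split; apply: sub_adjoin; exists v => //; [left | right].
Qed.

Lemma adjoin_free K (c d x y : R) : is_subfield K -> K c -> K d ->
  adjoin K [set c + x; d + y] = adjoin (adjoin K [set x]) [set y].
Proof.
move=> hK Kc Kd; rewrite adjoin_adjoin.
have h1 := adjoin_subfield K [set c + x; d + y].
have h2 := adjoin_subfield K ([set x] `|` [set y]).
have b1 := @sub_adjoin_base _ K [set c + x; d + y].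
have b2 := @sub_adjoin_base _ K ([set x] `|` [set y]).
have x2 : adjoin K ([set x] `|` [set y]) x by apply: sub_adjoin; left.
have y2 : adjoin K ([set x] `|` [set y]) y by apply: sub_adjoin; right.
have x1 : adjoin K [set c + x; d + y] (c + x) by apply: sub_adjoin; left.
have y1 : adjoin K [set c + x; d + y] (d + y) by apply: sub_adjoin; right.
have [c1 d1] := (b1 _ Kc, b1 _ Kd); have [c2 d2] := (b2 _ Kc, b2 _ Kd).
apply: eq_adjoin => z [] ->.
- by in_subfield h2.
- by in_subfield h2.
- by rewrite [X in adjoin _ _ X](_ : x = c + x - c); [in_subfield h1 | ring].
- by rewrite [X in adjoin _ _ X](_ : y = d + y - d); [in_subfield h1 | ring].
Qed.

Lemma adjoin_scaled K (c1 c2 d1 d2 h : R) : is_subfield K ->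
  K c1 -> K c2 -> K d1 -> K d2 -> (d1 != 0) || (d2 != 0) ->
  adjoin K [set c1 + h * d1; c2 + h * d2] = adjoin K [set h].
Proof.
move=> hK Kc1 Kc2 Kd1 Kd2 dn0; set A := [set _; _].
have hA := adjoin_subfield K A; have hh := adjoin_subfield K [set h].
have bA := @sub_adjoin_base _ K A; have bh := @sub_adjoin_base _ K [set h].
have Ah : adjoin K [set h] h by apply: sub_adjoin.
have [c1h c2h] := (bh _ Kc1, bh _ Kc2); have [d1h d2h] := (bh _ Kd1, bh _ Kd2).
have [c1A c2A] := (bA _ Kc1, bA _ Kc2); have [d1A d2A] := (bA _ Kd1, bA _ Kd2).
apply: eq_adjoin => z; first by case=> ->; in_subfield hh.
move=> ->; case/orP: dn0 => d0.
- have z1 : adjoin K A (c1 + h * d1) by apply: sub_adjoin; left.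
  have -> : h = (c1 + h * d1 - c1) / d1 by field.
  by in_subfield hA.
- have z2 : adjoin K A (c2 + h * d2) by apply: sub_adjoin; right.
  have -> : h = (c2 + h * d2 - c2) / d2 by field.
  by in_subfield hA.
Qed.

(** The point is the midpoint plus [h] times a nonzero vector over [K], so its
    coordinates generate the same field as the square root [h]; when the radicand
    is negative, [h = 0]. *)
Lemma fold_field_triangle K sg c1 c2 : fold_field K -> point_over K c1 ->
  point_over K c2 -> c1 <> c2 ->
  fold_field (adjoin K [set (triangle_point sg c1 c2).1; (triangle_point sg c1 c2).2]).
Proof.
move=> fK [Kx1 Ky1] [Kx2 Ky2] c12; have hK := fold_field_subfield fK.
set D := 1 / edist c1 c2 ^+ 2 - 1 / 4.
have KD : K D.
  rewrite /D /edist sqr_sqrtr ?addr_ge0 ?sqr_ge0 //.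
  by in_subfield hK.
rewrite /triangle_point /= -/D -/(_ * _).
set h := (-1) ^+ sg * Num.sqrt D.
have Kh : K (h ^+ 2).
  rewrite /h exprMn sqrr_sign mul1r.
  case: (lerP 0 D) => D0; first by rewrite sqr_sqrtr.
  by rewrite ltr0_sqrtr // expr0n; apply: subfield0.
rewrite adjoin_scaled //; first exact: fold_field_sqrt.
- by in_subfield hK.
- by in_subfield hK.
- by rewrite opprK; in_subfield hK.
- by in_subfield hK.
- rewrite !oppr_eq0 !subr_eq0; apply/negPn/negP; rewrite negb_or !negbK.
  move=> /andP[/eqP e2 /eqP e1]; apply: c12.
  by case: c1 c2 e1 e2 {D KD h Kh Kx1 Ky1 Kx2 Ky2} => ? ? [? ?] /= -> ->.
Qed.

(** Along a placement the coordinate field grows by square roots only, as soon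
    as the ground field makes the cosines of the free angles quadratic. *)
Lemma fold_field_placed F s th : fold_field F ->
  placed e p s th ->
  (forall a, a \in th -> exists b c, [/\ F b, F c & cos a ^+ 2 = b * cos a + c]) ->
  fold_field (adjoin F (coordinates_on s)).
Proof.
move=> fF; have hF := fold_field_subfield fF.
elim=> {s th} [u v _ pu pv _|s th u v a _ IH _ us _ pv thq
              |s th u1 u2 v sg _ IH _ us1 us2 _ _ pn pv thq].
- rewrite adjoin_absorb // => x [w].
  rewrite !inE => /orP[]/eqP-> ; rewrite ?pu ?pv /= => -[] ->;
    by in_subfield hF.
- have fK := IH (fun b bth => thq b (@mem_behead _ (a :: th) b bth)).
  rewrite coordinates_on_cons; have [] := adjoin_coordinates F us.
  have sF := @sub_adjoin_base _ F (coordinates_on s).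
  set K := adjoin F _ in fK sF * => Ku1 Ku2.
  rewrite pv /= adjoin_free //; last exact: fold_field_subfield.
  have [b [c [Fb Fc cE]]] := thq a (mem_head _ _).
  have fK' := fold_field_quadratic fK (sF _ Fb) (sF _ Fc) cE.
  apply: fold_field_sqrt => //.
  have hK' := fold_field_subfield fK'.
  rewrite -(addKr (cos a ^+ 2) (sin a ^+ 2)) cos2Dsin2.
  have Kc : adjoin K [set cos a] (cos a) by apply: sub_adjoin.
  by in_subfield hK'.
- have fK := IH thq; rewrite coordinates_on_cons pv.
  exact: (fold_field_triangle _ fK (adjoin_coordinates F us1)
            (adjoin_coordinates F us2)).
Qed.

(** The cosine is the difference of the abscissae of the free vertex and of its
    neighbour. *)
Lemma cos_free_angle K s th a : is_subfield K -> coordinates_on s `<=` K ->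
  placed e p s th -> a \in th -> K (cos a).
Proof.
move=> hK + pl; elim: pl => {s th} [//|s th u v b _ IH _ us _ pv cK|
  s th u1 u2 v sg _ IH _ us1 us2 _ _ pn pv cK ath]; last first.
  apply: IH => // x [w ws xw]; apply: cK; exists w => //.
  by rewrite inE ws orbT.
rewrite inE => /predU1P[->|ath]; last first.
  by apply: IH => // x [w ws xw]; apply: cK; exists w => //; rewrite inE ws orbT.
have -> : cos b = (p v).1 - (p u).1 by rewrite pv /=; ring.
apply: (subfieldB hK); apply: cK.
  by exists v; [rewrite mem_head | left].
by exists u; [rewrite inE us orbT | left].
Qed.

End PlacementFields.

(** * Triangle points *)

Section PlaneGeometry.
Variable R : realType.
Implicit Types P Q c : R * R.

Lemma sqr_edist P Q : edist P Q ^+ 2 = (P.1 - Q.1) ^+ 2 + (P.2 - Q.2) ^+ 2.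
Proof. by rewrite sqr_sqrtr // addr_ge0 ?sqr_ge0. Qed.

(** The difference between [P] and the midpoint is orthogonal to [c2 - c1], and
    its length is forced by Pythagoras. *)
Lemma triangle_point_complete c1 c2 P : c1 <> c2 ->
  edist c1 P = 1 -> edist c2 P = 1 -> exists sg, P = triangle_point sg c1 c2.
Proof.
move=> c12 /(congr1 (fun x => x ^+ 2)) e1 /(congr1 (fun x => x ^+ 2)) e2.
move: e1 e2; rewrite /triangle_point !sqr_edist expr1n.
case: c1 c2 P c12 => [x1 y1] [x2 y2] [x y] /= c12 e1 e2.
set d2 := (x1 - x2) ^+ 2 + (y1 - y2) ^+ 2.
have d0 : d2 != 0.
  rewrite paddr_eq0 ?sqr_ge0 // !sqrf_eq0 !subr_eq0.
  by apply/negP => /andP[/eqP ex /eqP ey]; apply: c12; rewrite ex ey.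
have perp0 : (x - (x1 + x2) / 2) * (x2 - x1) + (y - (y1 + y2) / 2) * (y2 - y1) = 0.
  transitivity (((x1 - x) ^+ 2 + (y1 - y) ^+ 2
    - ((x2 - x) ^+ 2 + (y2 - y) ^+ 2)) / 2); first by field.
  by rewrite e1 e2; ring.
pose l := ((x - (x1 + x2) / 2) * (y2 - y1) - (y - (y1 + y2) / 2) * (x2 - x1)) / d2.
have xE : x = (x1 + x2) / 2 + l * (y2 - y1).
  transitivity ((x1 + x2) / 2 + l * (y2 - y1) + (x2 - x1) / d2 *
    ((x - (x1 + x2) / 2) * (x2 - x1) + (y - (y1 + y2) / 2) * (y2 - y1))).
    by rewrite /l /d2; field.
  by rewrite perp0; ring.
have yE : y = (y1 + y2) / 2 - l * (x2 - x1).
  transitivity ((y1 + y2) / 2 - l * (x2 - x1) + (y2 - y1) / d2 *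
    ((x - (x1 + x2) / 2) * (x2 - x1) + (y - (y1 + y2) / 2) * (y2 - y1))).
    by rewrite /l /d2; field.
  by rewrite perp0; ring.
have le : l ^+ 2 * d2 + d2 / 4 = 1.
  by rewrite -[RHS]e1 xE yE /d2; field.
have ll : l ^+ 2 = 1 / d2 - 1 / 4.
  by apply: (mulIf d0); rewrite -[LHS](addrK (d2 / 4)) le; field.
have [sg lE] : exists sg : bool, l = (-1) ^+ sg * Num.sqrt (1 / d2 - 1 / 4).
  exists (l < 0); rewrite -ll sqrtr_sqr.
  by case: ltrP => l0; rewrite ?(ltr0_norm l0) ?(ger0_norm l0); ring.
by exists sg; rewrite -lE opprK mulrN; congr pair.
Qed.

Definition sqn (z : R[i]) : R := complex.Re z ^+ 2 + complex.Im z ^+ 2.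
Definition to_plane (z : R[i]) : R * R := (complex.Re z, complex.Im z).

Lemma sqnM z w : sqn (z * w) = sqn z * sqn w.
Proof. by case: z w => [a b] [c d]; rewrite /sqn /=; ring. Qed.

Lemma sqnN z : sqn (- z) = sqn z.
Proof. by case: z => a b; rewrite /sqn /= !sqrrN. Qed.

Lemma sqnX z n : sqn (z ^+ n) = sqn z ^+ n.
Proof.
elim: n => [|n IH]; last by rewrite !exprS sqnM IH.
by rewrite !expr0 /sqn /= expr1n expr0n addr0.
Qed.

Lemma edist_to_plane z w : edist (to_plane z) (to_plane w) = Num.sqrt (sqn (z - w)).
Proof. by case: z w => [a b] [c d]. Qed.

Lemma to_planeD z w : to_plane (z + w) = to_plane z + to_plane w.
Proof. by case: z w => [a b] [c d]. Qed.

Lemma to_plane_inj : injective to_plane.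
Proof. by move=> [a b] [c d] [-> ->]. Qed.

End PlaneGeometry.

Lemma eq_complexP (R : realType) (z w : R[i]) :
  complex.Re z = complex.Re w -> complex.Im z = complex.Im w -> z = w.
Proof. by case: z w => [a b] [c d] /= -> ->. Qed.

(** * The unit triangle whose rotations realize the graph *)

Section HepticTriangle.
Variables (R : realType) (g s t : R).
Hypothesis g_root : g ^+ 3 + g ^+ 2 - 2 * g - 1 = 0.
Hypothesis s2 : s ^+ 2 = 1 - g ^+ 2 / 4.
Hypothesis t2 : t ^+ 2 = 3.

Let P := g ^+ 3 + g ^+ 2 - 2 * g - 1.

Let om : R[i] := (g / 2 +i* s)%C.

(** With the centre of rotation at the origin, the first corner is
    [1 / (om - 1)]; the other two are solved from their distances to the centre,
    and then factor as [1 + i * sqrt 3] and [1 - i * sqrt 3] times elements of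
    [F(i * s)]. *)
Definition corner1 : R[i] := (- (1 / 2) -i* (s * (4 + 3 * g + g ^+ 2) / 7))%C.
Definition corner2 : R[i] :=
  (1 +i* t)%C * ((1 - g ^+ 2) / 4 -i* (s * (3 * g ^+ 2 + 2 * g - 2) / 14))%C.
Definition corner3 : R[i] :=
  (1 -i* t)%C * ((g ^+ 2 - 2) / 4 +i* (s * (2 * g ^+ 2 - g - 6) / 14))%C.
Definition sixth_root : R[i] := (1 / 2 +i* (t / 2))%C.

(** The triangle is equilateral: one side is another turned by a sixth root of
    unity. *)
Lemma corner3E : corner3 - corner1 = (corner2 - corner1) * sixth_root.
Proof.
apply: eq_complexP => /=.
  apply/eqP; rewrite -subr_eq0; apply/eqP.
  transitivity ((t ^+ 2 - 3) * (1 - g ^+ 2) / 8); first by field.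
  by rewrite t2; ring.
apply/eqP; rewrite -subr_eq0; apply/eqP.
transitivity (- (t ^+ 2 - 3) * s * (3 * g ^+ 2 + 2 * g - 2) / 28); first by field.
by rewrite t2; ring.
Qed.

Lemma om1_corner1 : (om - 1) * corner1 = 1.
Proof.
apply: eq_complexP => /=.
- transitivity (1 + (s ^+ 2 - (1 - g ^+ 2 / 4)) * (4 + 3 * g + g ^+ 2) / 7
    + P * (- (1 / 14) - g / 28)); first by rewrite /P; field.
  by rewrite s2 /P g_root subrr !mul0r !addr0.
- transitivity (s * P * (- (1 / 14))); first by rewrite /P; field.
  by rewrite /P g_root; ring.
Qed.

Lemma sqn_om : sqn om = 1.
Proof. by rewrite /sqn /= s2; field. Qed.

Lemma sqn_om1 : sqn (om - 1) = 2 - g.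
Proof. by rewrite /sqn /= subr0 s2; field. Qed.

Lemma sqn_om2 : sqn (om ^+ 2 - 1) = 4 - g ^+ 2.
Proof.
have -> : om ^+ 2 - 1 = (om - 1) * (om + 1) by ring.
rewrite sqnM sqn_om1; have -> : sqn (om + 1) = 2 + g.
  by rewrite /sqn /= addr0 s2; field.
by ring.
Qed.

Lemma sqn_om3 : sqn (om ^+ 3 - 1) = 2 + 3 * g - g ^+ 3.
Proof.
have -> : om ^+ 3 - 1 = (om - 1) * (om ^+ 2 + om + 1) by ring.
rewrite sqnM sqn_om1.
have -> : om ^+ 2 + om + 1 = om * (1 + g)%:C%C.
  apply: eq_complexP => /=; last by field.
  transitivity (g ^+ 2 / 4 - s ^+ 2 + g / 2 + 1); first by field.
  by rewrite s2; field.
by rewrite sqnM sqn_om /sqn /=; ring.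
Qed.

Lemma sqn_corner1 : sqn (om - 1) * sqn corner1 = 1.
Proof. by rewrite -sqnM om1_corner1 /sqn /= expr1n expr0n addr0. Qed.

Lemma sqn_corner2 : sqn (om ^+ 2 - 1) * sqn corner2 = 1.
Proof.
rewrite sqn_om2 sqnM /sqn /=.
transitivity ((4 - g ^+ 2) * ((1 + t ^+ 2) * (((1 - g ^+ 2) / 4) ^+ 2
  + s ^+ 2 * ((3 * g ^+ 2 + 2 * g - 2) / 14) ^+ 2))); first by field.
rewrite s2 t2.
transitivity (1 + P * (- (16 / 49) + 64 / 49 * g + 25 / 196 * g ^+ 2
  - 57 / 98 * g ^+ 3 + 3 / 196 * g ^+ 4 + 9 / 196 * g ^+ 5)).
  by rewrite /P; field.
by rewrite /P g_root; ring.
Qed.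

Lemma sqn_corner3 : sqn (om ^+ 3 - 1) * sqn corner3 = 1.
Proof.
rewrite sqn_om3 sqnM /sqn /=.
transitivity ((2 + 3 * g - g ^+ 3) * ((1 + t ^+ 2) * (((g ^+ 2 - 2) / 4) ^+ 2
  + s ^+ 2 * ((2 * g ^+ 2 - g - 6) / 14) ^+ 2))); first by field.
rewrite s2 t2.
transitivity (1 + P * (- (121 / 49) - 37 / 49 * g + 79 / 49 * g ^+ 2
  + 26 / 49 * g ^+ 3 - 3 / 7 * g ^+ 4 - 2 / 49 * g ^+ 5 + 1 / 49 * g ^+ 6)).
  by rewrite /P; field.
by rewrite /P g_root; ring.
Qed.

Lemma sqn_side12 : sqn (corner2 - corner1) = 1.
Proof.
transitivity (((3 - g ^+ 2) / 4) ^+ 2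
  + s ^+ 2 * t ^+ 2 * ((3 * g ^+ 2 + 2 * g - 2) / 14) ^+ 2
  + s ^+ 2 * ((10 + 4 * g - g ^+ 2) / 14) ^+ 2
  + t ^+ 2 * ((1 - g ^+ 2) / 4) ^+ 2
  + 2 * s * t * P * (- (1 / 14) - g / 28)).
  by rewrite /sqn /= /P; field.
rewrite s2 t2.
transitivity (1 + P * (- (9 / 28) + 5 / 14 * g - 1 / 28 * g ^+ 3
  + 2 * s * t * (- (1 / 14) - g / 28))); first by rewrite /P; field.
by rewrite /P g_root; ring.
Qed.

Lemma sqn_sixth_root : sqn sixth_root = 1.
Proof.
rewrite /sqn /=; transitivity (1 / 4 + t ^+ 2 / 4); first by field.
by rewrite t2; field.
Qed.

Lemma sqn_sixth_root1 : sqn (sixth_root - 1) = 1.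
Proof.
rewrite /sqn /=; transitivity (1 / 4 + t ^+ 2 / 4); first by field.
by rewrite t2; field.
Qed.

Lemma sqn_side13 : sqn (corner3 - corner1) = 1.
Proof. by rewrite corner3E sqnM sqn_side12 sqn_sixth_root mul1r. Qed.

Lemma sqn_side23 : sqn (corner3 - corner2) = 1.
Proof.
have -> : corner3 - corner2 = (corner2 - corner1) * (sixth_root - 1).
  by rewrite mulrBr -corner3E; ring.
by rewrite sqnM sqn_side12 sqn_sixth_root1 mul1r.
Qed.

(** The real part of the side between the first two corners, turned by [om], is
    half the root of the quadratic factor attached to [g]. *)
Lemma re_side12 : 2 * complex.Re (om * (corner2 - corner1)) =
  (g ^+ 2 - 3) / 2 + (3 * g ^+ 2 + 2 * g - 2) / 7 * s * t.
Proof.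
apply/eqP; rewrite -subr_eq0; apply/eqP => /=.
transitivity (- (s ^+ 2 - (1 - g ^+ 2 / 4)) * (10 + 4 * g - g ^+ 2) / 7
  + P * (- (1 / 14) - g / 28) + P * s * t * 3 / 14).
  by rewrite /P; field.
by rewrite s2 /P g_root; ring.
Qed.

Lemma root_side12 :
  root (sextic R) (2 * complex.Re (om * (corner2 - corner1))).
Proof.
rewrite (sextic_factorization g_root) rootZ ?pnatr_eq0 // !rootM.
rewrite root_sextic_factor re_side12; apply/orP; left; apply/orP; left; apply/eqP.
transitivity (s ^+ 2 * t ^+ 2 * ((3 * g ^+ 2 + 2 * g - 2) / 7) ^+ 2
  - (3 - g ^+ 2) ^+ 2 / 4 + (11 - 4 * g - 6 * g ^+ 2) / 7); first by field.
rewrite s2 t2.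
transitivity (P * (85 / 196 + 19 / 98 * g - 9 / 196 * g ^+ 2 - 27 / 196 * g ^+ 3)).
  by rewrite /P; field.
by rewrite /P g_root mul0r.
Qed.

End HepticTriangle.

(** * The braced heptagon *)

Section Triangulation.
Variables (R : realType) (V : finType) (e : rel V) (p : V -> R * R).
Hypotheses (p_unit : unit_distance_realization e p) (p_inj : injective p).

Fixpoint triangle_order (s : seq V) (l : seq (V * V * V)) : bool :=
  if l is (u1, u2, v) :: l' then
    [&& v \notin s, u1 \in s, u2 \in s, e u1 v, e u2 v, u1 != u2
      & triangle_order (v :: s) l']
  else true.

(** No signs have to be given: unit distances to two distinct placed vertices
    leave only their two triangle points. *)
Lemma placed_triangles s th l : placed e p s th -> triangle_order s l ->
  placed e p (rev [seq x.2 | x <- l] ++ s) th.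
Proof.
elim: l s => [//|[[u1 u2] v] l IH] s pl /=.
case/and5P => vs us1 us2 e1 /and3P[e2 u12 tl].
rewrite rev_cons cat_rcons; apply: IH => //.
have p12 : p u1 <> p u2 by move=> /p_inj /eqP; apply/negP.
have [sg pv] := triangle_point_complete p12 (p_unit e1) (p_unit e2).
exact: PlaceTriangle pl vs us1 us2 e1 e2 p12 pv.
Qed.

End Triangulation.

Section BracedHeptagon.
Variable R : realType.
Local Notation theta := (2 * pi / 7 : R).
Local Notation g := (2 * cos theta : R).
Local Notation s := (sin theta : R).
Local Notation t := (Num.sqrt 3 : R).

Definition omega : R[i] := (cos theta +i* sin theta)%C.
Definition corner (r : 'I_3) : R[i] :=
  nth 0 [:: corner1 g s; corner2 g s t; corner3 g s t] r.

Lemma heptic_sin : s ^+ 2 = 1 - g ^+ 2 / 4.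
Proof.
by rewrite -(addKr (cos theta ^+ 2) (s ^+ 2)) cos2Dsin2; field.
Qed.

Lemma sqrt3 : t ^+ 2 = 3.
Proof. by rewrite sqr_sqrtr ?ler0n. Qed.

Lemma omegaE : omega = (g / 2 +i* s)%C.
Proof. by rewrite /omega; congr Complex; field. Qed.

Lemma omegaX n : omega ^+ n = (cos (theta *+ n) +i* sin (theta *+ n))%C.
Proof.
elim: n => [|n IH]; first by rewrite expr0 mulr0n cos0 sin0.
rewrite exprS IH [theta *+ n.+1]mulrS /omega cosD sinD.
by apply: eq_complexP => /=; ring.
Qed.

Lemma omega7 : omega ^+ 7 = 1.
Proof.
rewrite omegaX (_ : theta *+ 7 = 0 + pi *+ 2); last by field.
by rewrite cosD2pi sinD2pi cos0 sin0.
Qed.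

Lemma omega_neq1 : omega != 1.
Proof.
apply/eqP => o1; have := sqn_om1 heptic_sin; rewrite -omegaE o1 subrr.
have := heptic_cos_root R; set x := g => x0 e; have x2 : x = 2.
  by apply/eqP; rewrite -subr_eq0 -opprB -e /sqn /= expr0n addr0 oppr0.
by move: x0; rewrite x2; clear o1; lra.
Qed.

Lemma omega_eq m n : (omega ^+ m == omega ^+ n) = (m == n %[mod 7]).
Proof.
have [k prim kd] := prim_order_exists (isT : (0 < 7)%N) omega7.
rewrite (eq_prim_root_expr prim).
have [_ /(_ _ kd) /pred2P[k1|-> //]] := primeP (isT : prime 7).
have := prim_expr_order prim; rewrite k1 expr1 => /eqP.
by rewrite (negPf omega_neq1).
Qed.

Lemma sqn_omega n : sqn (omega ^+ n) = 1.
Proof. by rewrite sqnX omegaE (sqn_om heptic_sin) expr1n. Qed.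

Lemma sqn_rotate m n z : sqn (omega ^+ m * omega ^+ n * z) = sqn z.
Proof. by rewrite sqnM [sqn (_ * _)]sqnM !sqn_omega !mul1r. Qed.

Lemma omegaD (k l : 'Z_7) : omega ^+ (k + l)%R = omega ^+ k * omega ^+ l.
Proof. by rewrite -exprD -[RHS](expr_mod _ omega7). Qed.

Lemma sqn_corner (r : 'I_3) : sqn (omega ^+ r.+1 - 1) * sqn (corner r) = 1.
Proof.
have g0 := heptic_cos_root R; have s2 := heptic_sin; have t2 := sqrt3.
rewrite omegaE; case: r => [[|[|[|//]]] ?] /=.
- exact: sqn_corner1.
- exact: sqn_corner2.
- exact: sqn_corner3.
Qed.

(** The three exponents differ so that the edges joining different orbits,
    which shift the second index, become sides of one rotated triangle; the first
    is [4] so that the vertex [(0, 3)], placed at the origin of coordinates, is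
    rotated by [omega ^+ 7 = 1]. *)
Definition shift (r : 'I_3) : nat := nth 0%N [:: 4; 3; 5] r.

Definition rotated_corner (v : vertex21) : R[i] :=
  omega ^+ (v.2 + shift v.1) * corner v.1.

Lemma sqn_arc u v : arc21 u v ->
  sqn (rotated_corner v - rotated_corner u) = 1.
Proof.
have g0 := heptic_cos_root R; have s2 := heptic_sin; have t2 := sqrt3.
case: u v => [r k] [r' l]; rewrite /arc21 /rotated_corner /=.
case/or4P => [/andP[/eqP <- /eqP ->] | /and3P[/eqP-> /eqP-> /eqP->]
  | /and3P[/eqP-> /eqP-> /eqP->] | /and3P[/eqP-> /eqP-> /eqP->]];
  rewrite exprD omegaD exprD.
- have -> : omega ^+ ((r.+1)%:R : 'Z_7) = omega ^+ r.+1.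
    by case: r => [[|[|[|//]]] ?].
  have -> : omega ^+ k * omega ^+ r.+1 * omega ^+ shift r * corner r -
      omega ^+ k * omega ^+ shift r * corner r =
    omega ^+ k * omega ^+ shift r * ((omega ^+ r.+1 - 1) * corner r) by ring.
  by rewrite sqn_rotate sqnM sqn_corner.
- have -> : omega ^+ k * omega ^+ (1 : 'Z_7)%R * omega ^+ shift 1 * corner 1 -
      omega ^+ k * omega ^+ shift 0 * corner 0 =
    omega ^+ k * omega ^+ 4 * (corner 1 - corner 0).
    by rewrite /shift /=; ring.
  by rewrite sqn_rotate; exact: (sqn_side12 g0 s2 t2).
- have -> : omega ^+ k * omega ^+ (- 1 : 'Z_7)%R * omega ^+ shift 2%:R * corner 2%:R -
      omega ^+ k * omega ^+ shift 0 * corner 0 =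
    omega ^+ k * omega ^+ 4 * (omega ^+ 7 * corner 2%:R - corner 0).
    by rewrite /shift /=; ring.
  by rewrite omega7 mul1r sqn_rotate; exact: (sqn_side13 g0 s2 t2).
- have -> : omega ^+ k * omega ^+ (- 2%:R : 'Z_7)%R * omega ^+ shift 2%:R
      * corner 2%:R -
      omega ^+ k * omega ^+ shift 1 * corner 1 =
    omega ^+ k * omega ^+ 3 * (omega ^+ 7 * corner 2%:R - corner 1).
    by rewrite /shift /=; ring.
  by rewrite omega7 mul1r sqn_rotate; exact: (sqn_side23 g0 s2 t2).
Qed.

Lemma sqn_omegaB1 n : sqn (omega ^+ n - 1) = 2 - 2 * cos (theta *+ n).
Proof.
rewrite omegaX /sqn /= subr0.
transitivity ((cos (theta *+ n) ^+ 2 + sin (theta *+ n) ^+ 2)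
  + 1 - 2 * cos (theta *+ n)); first by ring.
by rewrite cos2Dsin2; ring.
Qed.

(** The three orbits lie on circles of different radii, and [omega] has
    order 7. *)
Lemma rotated_corner_inj : injective rotated_corner.
Proof.
move=> [r k] [r' l] /= e.
have c0 (i : 'I_3) : sqn (corner i) != 0.
  by apply/eqP => ci; have /eqP := sqn_corner i; rewrite ci mulr0 eq_sym oner_eq0.
have rr : r = r'.
  have ec : sqn (corner r) = sqn (corner r').
    by have := congr1 (@sqn R) e; rewrite !sqnM !sqn_omega !mul1r.
  have := sqn_corner r'; rewrite -ec -(sqn_corner r) => /(mulIf (c0 r)).
  rewrite !sqn_omegaB1 => /addrI /oppr_inj /(mulfI _) ecos.
  have t0 := heptic_theta_bounds R; have p0 := pi_gt0 R.
  have itv (i : 'I_3) : theta *+ i.+1 \in `[0, pi].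
    rewrite in_itv /= mulrn_wge0 /=; last by case/andP: t0 => /ltW.
    have i3 : (i.+1)%:R <= 3 :> R by rewrite ler_nat.
    by rewrite -mulr_natr; nra.
  have {}ecos : cos (theta *+ r'.+1) = cos (theta *+ r.+1).
    by apply: ecos; rewrite pnatr_eq0.
  have theta_neq0 : theta != 0 by case/andP: t0 => tp _; rewrite gt_eqF.
  have := mulrIn theta_neq0 (cos_inj (itv r') (itv r) ecos).
  by case=> /val_inj.
rewrite -{r'}rr in e *; congr pair.
have /mulIf e' : corner r != 0.
  by apply: contraNneq (c0 r) => ->; rewrite /sqn /= expr0n addr0.
move/e'/eqP: e; rewrite omega_eq eqn_modDr !modn_small ?ltn_ord // => /eqP.
exact: val_inj.
Qed.

Definition heptagon_point (v : vertex35) : R * R :=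
  to_plane (rotated_corner (val v) - rotated_corner (0, 3%:R)).

Lemma heptagon_unit : unit_distance_realization braced_heptagon heptagon_point.
Proof.
move=> u v uv; rewrite edist_to_plane.
have -> (x y z : R[i]) : x - z - (y - z) = x - y by ring.
case/orP: uv => /sqn_arc h; last by rewrite h sqrtr1.
by rewrite -opprB sqnN h sqrtr1.
Qed.

Lemma heptagon_inj : injective heptagon_point.
Proof. by move=> u v /to_plane_inj /addIr /rotated_corner_inj /val_inj. Qed.

Local Notation vx r k := (exist _ (r%R : 'I_3, k%R : 'Z_7) isT : vertex35).

Lemma heptagon_step (u v : vertex35) z :
  rotated_corner (val v) - rotated_corner (val u) = z ->
  heptagon_point v = heptagon_point u + to_plane z.
Proof. by move=> <-; rewrite -to_planeD; congr to_plane; ring. Qed.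

Definition heptagon_base : seq vertex35 :=
  [:: vx 0 2; vx 1 5; vx 0 5; vx 0 4; vx 0 3].

(** These vertices carry three consecutive edges of the first orbit, whose
    directions are powers of [omega], and one side of a rotated triangle. *)
Lemma heptagon_placed a2 :
  to_plane (omega * (corner2 g s t - corner1 g s)) = (cos a2, sin a2) ->
  placed braced_heptagon heptagon_point
    heptagon_base [:: 5 * pi / 7; a2; 2 * pi / 7].
Proof.
move=> side.
have rotate n : omega ^+ (7 + n) = omega ^+ n by rewrite exprD omega7 mul1r.
have o1 : (omega - 1) * corner1 g s = 1.
  by rewrite omegaE; apply: om1_corner1; [exact: heptic_cos_root | exact: heptic_sin].
have p3 : rotated_corner (0, 3%:R) = corner1 g s.
  by rewrite /rotated_corner /= (rotate 0%N) mul1r.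
have p4 : rotated_corner (0, 4%:R) = omega * corner1 g s.
  by rewrite /rotated_corner /= (rotate 1%N).
have p5 : rotated_corner (0, 5%:R) = omega ^+ 2 * corner1 g s.
  by rewrite /rotated_corner /= (rotate 2%N).
have q5 : rotated_corner (1, 5%:R) = omega * corner2 g s t.
  by rewrite /rotated_corner /= (rotate 1%N).
have p2 : rotated_corner (0, 2%:R) = omega ^+ 6 * corner1 g s by [].
apply: (PlaceFree (u := vx 0 3)) => //; last first.
  rewrite (@heptagon_step (vx 0 3) _ (- omega ^+ 6)); last first.
    rewrite /= p2 p3 -[X in _ - X]mul1r -omega7.
    by rewrite -[RHS]mulr1 -o1; ring.
  congr (_ + _); rewrite omegaX (_ : theta *+ 6 = 5 * pi / 7 + pi); last by field.
  by rewrite /to_plane /= cosDpi sinDpi !opprK.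
apply: (PlaceFree (u := vx 0 4)) => //; last first.
  rewrite -side; apply: heptagon_step; by rewrite /= q5 p4; ring.
apply: (PlaceFree (u := vx 0 4)) => //; last first.
  apply: (heptagon_step (z := omega)); rewrite /= p5 p4.
  by rewrite -[RHS]mulr1 -o1; ring.
apply: PlaceBase => //.
  by rewrite /heptagon_point subrr.
by rewrite /heptagon_point /= p3 p4 -[X in _ - X]mul1r -mulrBl o1.
Qed.

Definition heptagon_order : seq (vertex35 * vertex35 * vertex35) :=
  [:: (vx 1 5, vx 0 2, vx 1 3); (vx 0 2, vx 1 3, vx 2 1);
      (vx 0 4, vx 1 5, vx 2 3); (vx 0 5, vx 2 1, vx 2 4);
      (vx 0 5, vx 2 4, vx 1 6); (vx 1 3, vx 1 6, vx 1 1);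
      (vx 0 3, vx 1 6, vx 1 4); (vx 2 3, vx 2 4, vx 2 0);
      (vx 1 4, vx 2 0, vx 1 2); (vx 1 5, vx 1 2, vx 1 0);
      (vx 0 5, vx 1 0, vx 0 6); (vx 0 3, vx 1 4, vx 2 2);
      (vx 2 1, vx 1 0, vx 2 5); (vx 2 3, vx 1 1, vx 2 6)].

Lemma heptagon_orderP : triangle_order braced_heptagon
  heptagon_base heptagon_order.
Proof. by vm_compute. Qed.

Lemma heptagon_order_complete v : 
  v \in rev [seq x.2 | x <- heptagon_order] ++ heptagon_base.
Proof.
case: v => [[[r hr] [k hk]] hv].
by do 3?[case: r hr hv => [|r] hr hv //]; do 7?[case: k hk hv => [|k] hk hv //].
Qed.

Lemma braced_heptagon_realization : exists (zeta : R[i]) a2 p,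
  is_zeta_angle zeta a2 /\
  constructed_realization braced_heptagon [:: 5 * pi / 7; a2; 2 * pi / 7] p.
Proof.
have g0 := heptic_cos_root R; have s2 := heptic_sin; have t2 := sqrt3.
pose z := omega * (corner2 g s t - corner1 g s).
have z1 : complex.Re z ^+ 2 + complex.Im z ^+ 2 = 1.
  by rewrite -/(sqn z) sqnM omegaE (sqn_om s2) (sqn_side12 g0 s2 t2) mulr1.
have rz : root (sextic R) (2 * complex.Re z).
  by rewrite /z omegaE; apply: root_side12.
have [a2 [za ca sa]] := zeta_angle_exists z1 rz.
exists (complex.Re z +i* complex.Im z)%C, a2, heptagon_point; split; first exact: za.
split; first exact: heptagon_unit.
have side : to_plane z = (cos a2, sin a2) by rewrite ca sa.
have pl := placed_triangles heptagon_unit heptagon_inj (heptagon_placed side)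
  heptagon_orderP.
exists (rev [seq x.2 | x <- heptagon_order] ++ heptagon_base),
  [:: 5 * pi / 7; a2; 2 * pi / 7].
by split; [exact: pl | exact: heptagon_order_complete |].
Qed.

End BracedHeptagon.

(** * Origami constructibility *)

(** The ground field may be enlarged to the cubic field at no cost, since the
    coordinates of the free vertices generate [cos (2 * pi / 7)]. *)
Lemma fold_field_constructed (R : realType) (V : finType) (e : rel V)
    (zeta : R[i]) (a2 : R) (p : V -> R * R) :
  is_zeta_angle zeta a2 ->
  constructed_realization e [:: 5 * pi / 7; a2; 2 * pi / 7] p ->
  fold_field (adjoin (QQ R) (coordinates p)).
Proof.
have g_root := heptic_cos_root R; set g := 2 * _ in g_root.
have FE : F7 R = adjoin (QQ R) [set g] by apply: F7E.
move=> /zeta_angle_sextic ra [_ [s [th [pl sV thE]]]].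
have hF := adjoin_subfield (QQ R) [set g].
have Fg : adjoin (QQ R) [set g] g by apply: sub_adjoin.
have Fc : adjoin (QQ R) [set g] (cos (2 * pi / 7)).
  by rewrite -FE; apply: sub_adjoin.
have sE : coordinates_on p s = coordinates p.
  by apply/seteqP; split=> x [v]; [exists v | exists v].
have -> : adjoin (QQ R) (coordinates p) =
    adjoin (adjoin (QQ R) [set g]) (coordinates_on p s).
  rewrite sE adjoin_adjoin; apply: eq_adjoin => x; last case.
  - by move=> px; apply: sub_adjoin; right.
  - move=> ->; have hC := adjoin_subfield (QQ R) (coordinates p).
    apply: (subfieldM hC); first exact: (subfield_nat hC).
    apply: (cos_free_angle hC _ pl); first by rewrite sE; apply: sub_adjoin.
    by rewrite (perm_mem thE) !inE eqxx !orbT.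
  - by move=> px; apply: sub_adjoin.
apply: (fold_field_placed (fold_field_heptic g_root) pl) => a.
rewrite (perm_mem thE) !inE => /or3P[]/eqP->.
- have -> : 5 * pi / 7 = - (2 * pi / 7) + pi :> R by field.
  rewrite cosDpi cosN sqrrN; exists 0, (cos (2 * pi / 7) ^+ 2).
  by rewrite mul0r add0r; split=> //; in_subfield hF.
- have [b [c [Fb Fc' quad]]] := sextic_root_quadratic g_root ra.
  exists (b / 2), (c / 4); split; [by in_subfield hF..|].
  apply: (@mulfI _ 4) => //; transitivity ((2 * cos a2) ^+ 2); first by ring.
  by rewrite quad; field.
- exists 0, (cos (2 * pi / 7) ^+ 2).
  by rewrite mul0r add0r; split=> //; in_subfield hF.
Qed.

Lemma angle_fieldE (R : realType) (a2 : R) :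
  adjoin (QQ R) [set cos (2 * pi / 7); cos a2] =
  adjoin (F7 R) [set 2 * cos a2].
Proof.
rewrite /F7 adjoin_adjoin; set A := [set _; _]; set B := _ `|` _.
have hA := adjoin_subfield (QQ R) A; have hB := adjoin_subfield (QQ R) B.
have A1 : adjoin (QQ R) A (cos (2 * pi / 7)) by apply: sub_adjoin; left.
have A2 : adjoin (QQ R) A (cos a2) by apply: sub_adjoin; right.
have B1 : adjoin (QQ R) B (cos (2 * pi / 7)) by apply: sub_adjoin; left.
have B2 : adjoin (QQ R) B (2 * cos a2) by apply: sub_adjoin; right.
apply: eq_adjoin => _ [->|->] //; last by in_subfield hA.
by rewrite (_ : cos a2 = 2 * cos a2 / 2); [in_subfield hB | field].
Qed.

Theorem theorem5p2 (R : realType) :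
  (exists q : 'I_3 -> {poly R},
     [/\ forall i, size (q i) = 3%N /\ q i \is monic,
         forall i, coefs_in (F7 R) (q i),
         sextic R = 7%:R *: \prod_(i < 3) q i
       & forall i j, exists2 s, is_aut (QQ R) (F7 R) s
           & map_poly s (q i) = q j])
  /\
  (forall (zeta : R[i]) (a2 : R), is_zeta_angle zeta a2 ->
    let F := F7 R in
    let L := adjoin (QQ R) [set cos (2 * pi / 7); cos a2] in
    [/\ root (sextic R) (2 * cos a2)
          /\ field_degree F (adjoin F [set 2 * cos a2]) 2,
        [/\ cyclic_extension (QQ R) F 3, field_degree F L 2
          & field_degree (QQ R) L 6]
      & forall p : vertex35 -> R * R,
          constructed_realization braced_heptagon
            [:: 5 * pi / 7; a2; 2 * pi / 7] p ->
          let K := adjoin (QQ R) (coordinates p) in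
          [/\ tower (@fold_step R) K,
              exists k : nat, field_degree (QQ R) K (3 * 2 ^ k)
            & forall x, coordinates p x -> origami_number x]])
  /\
  (exists (zeta : R[i]) (a2 : R) (p : vertex35 -> R * R),
     is_zeta_angle zeta a2 /\
     constructed_realization braced_heptagon
       [:: 5 * pi / 7; a2; 2 * pi / 7] p)
  /\ origami_constructible R braced_heptagon.
Proof.
have g_root := heptic_cos_root R; set g := 2 * _ in g_root.
have FE : F7 R = adjoin (QQ R) [set g] by apply: F7E.
split; last split; last split.
- exists (fun i => sextic_factor (iter i (@tau R) g)); split.
  + by move=> i; rewrite size_monic_quadratic monic_monic_quadratic.
  + by move=> i; rewrite FE; apply: sextic_factor_coefs.
  + by rewrite (sextic_factorization g_root) !big_ord_recr big_ord0 /= mul1r.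
  + move=> i j; have [s hs sE] := heptic_aut g_root.
    have sg : s g = tau g by rewrite -{1}(qevalX g) sE qevalX.
    (* [s] moves the i-th conjugate to the j-th one after [j - i] steps modulo 3 *)
    exists (iter (j + (3 - i)) s); first by rewrite FE; apply: aut_iter.
    have Fi : adjoin (QQ R) [set g] (iter i (@tau R) g) by apply: iter_tau_in.
    rewrite (map_sextic_factor (aut_iter _ hs) Fi).
    congr sextic_factor; rewrite -(aut_iter_tau i hs sg) -iterD -addnA.
    rewrite (subnK (ltnW (ltn_ord i))) (aut_iter_tau _ hs sg).
    by rewrite iterD -[X in iter j _ X]/(tau (tau (tau g))) (tau3 g_root).
- move=> zeta a2 za; have ra := zeta_angle_sextic za.
  have hF := adjoin_subfield (QQ R) [set g].
  have d2 : field_degree (F7 R) (adjoin (F7 R) [set 2 * cos a2]) 2.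
    have [b [c [Fb Fc e]]] := sextic_root_quadratic g_root ra.
    rewrite FE; apply: (quadratic_degree hF Fb Fc _ e).
    exact: sextic_root_notin.
  have c3 : cyclic_extension (QQ R) (F7 R) 3 by rewrite FE; apply: heptic_cyclic.
  split; [by [] | split=> //; rewrite angle_fieldE // | ].
    by apply: (field_degree_mul _ d2 : field_degree _ _ (3 * 2)); case: c3.
  move=> p /(fold_field_constructed za) fK; split; [by case: fK | by case: fK |].
  by move=> x px; apply: (fold_field_origami fK); apply: sub_adjoin.
- exact: braced_heptagon_realization.
- have [zeta [a2 [p [za cp]]]] := braced_heptagon_realization R.
  exists p; first by case: cp.
  move=> x px; apply: (fold_field_origami (fold_field_constructed za cp)).
  exact: sub_adjoin.
Qed.
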